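(* Let $r,p,\tau,\alpha,\beta$ be as in the context, and consider the equation $$(E)\qquad (r(t)\Phi(y'))'=p(t)\Phi(y(\tau(t))).$$ Assume that $p\in\mathcal{RV}(\delta)$ and $r\in\mathcal{RV}(\delta+\alpha)$ with $\delta<-1$. Let $$(r^{1-\beta}\circ\tau)\,\tau'\in\mathcal{RV}(\delta(1-\beta)-\beta)\quad\text{and}\quad\left(\frac{L_p(t)}{L_r(t)}\right)^{\beta-1}\tau'(t)\to0\ \text{ as }t\to\infty.$$ Put $\varrho=\dfrac{-1-\delta}{\alpha-1}$. Then $\mathcal{IS}\subset\mathcal{NRV}(\varrho)$, and $y^{[1]}\in\Pi\big(tp(t)\Phi(y(\tau(t)))\big)$ for every $y\in\mathcal{IS}$. In addition, for any $y\in\mathcal{IS}$ the following hold. (i) If $\int_a^\infty H_\tau(s)\,ds=\infty$, then $$y(t)=t\,r^{1-\beta}(t)\exp\left\{\int_a^t(1+o(1))\frac{\beta-1}{\Phi(\varrho)}H_\tau(s)\,ds\right\}\quad\text{as }t\to\infty.$$ Moreover, $\mathcal S_{\mathcal{NRV}}(\varrho)=\mathcal S_{\mathcal{RV}}(\varrho)=\mathcal{IS}=\mathcal{IS}_{\infty,\infty}$. (ii) If $\int_a^\infty H_\tau(s)\,ds<\infty$, then $$y(t)=A+\int_a^tM^{\beta-1}r^{1-\beta}(s)\exp\left\{-\int_s^\infty(1+o(1))\frac{\beta-1}{\varrho^{\alpha-1}}H_\tau(\xi)\,d\xi\right\}ds\quad\text{as }t\to\infty,$$ where $M=\lim_{t\to\infty}y^{[1]}(t)\in(0,\infty)$,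 for some $A\in\mathbb R$, and $\mathcal S_{\mathcal{NRV}}(\varrho)=\mathcal S_{\mathcal{RV}}(\varrho)=\mathcal{IS}=\mathcal{IS}_{\infty,B}$. Moreover, $M-y^{[1]}\in\mathcal{SV}$ and $$\frac{t^{\delta+\alpha}(\tau'(t))^{\alpha-1}L_p(t)}{\tau^{\delta+\alpha}(t)L_r(t)(M-y^{[1]}(t))}=o(1)\quad\text{as }t\to\infty.$$
   Context: Setting. $a>0$; $r,p:[a,\infty)\to(0,\infty)$ are continuous; $\alpha>1$, $\Phi(u)=|u|^{\alpha-1}\operatorname{sgn}u$; $\beta$ is the conjugate number of $\alpha$, $1/\alpha+1/\beta=1$. The delay $\tau$ satisfies $\tau\in C^1$, $\tau'>0$, $\tau(t)\le t$, and $\limsup_{t\to\infty}t/\tau(t)<\infty$ (hence $\tau(t)\to\infty$). Put $$H_\tau(t)=(t\tau'(t))^{\alpha-1}\frac{p(t)}{r(\tau(t))}.$$ Solutions. A solution $y$ of (E) is a $C^1$ function on an interval $I\subseteq[a,\infty)$ with $r\Phi(y')\in C^1(I)$ satisfying the equation in $I$. $\mathcal S$ is the set of $y$ that are positive solutions of (E) for large $t$. $\mathcal{IS}=\{y\in\mathcal S: y'(t)>0\text{ for large }t\}$. Quasiderivative: $y^{[1]}=r\Phi(y')$. For $u,v\in\{B,\infty\}$, $\mathcal{IS}_{u,v}=\{y\in\mathcal{IS}:\lim_{t\to\infty}y(t)=u,\ \lim_{t\to\infty}y^{[1]}(t)=v\}$, where the value $B$ means that the corresponding limit is a finite nonzero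 real number. Regular variation. A measurable $f:[a,\infty)\to(0,\infty)$ (positivity and all statements for large $t$ suffice) is in $\mathcal{RV}(\vartheta)$, $\vartheta\in\mathbb R$, if $\lim_{t\to\infty}f(\lambda t)/f(t)=\lambda^\vartheta$ for every $\lambda>0$; $\mathcal{SV}=\mathcal{RV}(0)$. For $f\in\mathcal{RV}(\vartheta)$, $L_f(t)=f(t)/t^\vartheta$. $f\in\mathcal{NRV}(\vartheta)$ (normalized) if $f(t)=Ct^\vartheta\exp\{\int_{t_0}^t\psi(s)/s\,ds\}$ for $t\ge t_0$, for some $t_0>0$, with $C\in(0,\infty)$ and $\psi$ measurable, $\psi(t)\to0$ as $t\to\infty$; for $f\in C^1$ this is equivalent to $tf'(t)/f(t)\to\vartheta$. $\mathcal S_{\mathcal{RV}}(\vartheta)=\mathcal S\cap\mathcal{RV}(\vartheta)$, $\mathcal S_{\mathcal{NRV}}(\vartheta)=\mathcal S\cap\mathcal{NRV}(\vartheta)$. A measurable real function $f$ belongs to the de Haan class $\Pi(w)$, with $w$ positive, if $\lim_{t\to\infty}(f(\lambda t)-f(t))/w(t)=\ln\lambda$ for every $\lambda>0$. Conventions. Expressions containing $r(\tau(t))$ are considered for $t$ so large that $\tau(t)\ge a$; where necessary the lower limit $a$ in integrals of such expressions is replaced by a sufficiently large number. In both (i) and (ii), the $o(1)$ inside an integral is a function of the integration variable: in (i), $1+o(1)$ stands for $1+\varepsilon(s)$ with some function $\varepsilon(s)\to0$ as $s\to\infty$, and in (ii) for $1+\varepsilon(\xi)$ with some function $\varepsilon(\xi)\to0$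 as $\xi\to\infty$. The formulae hold for large $t$.
   Formalization: In (i) the equality for y(t) is proved up to a factor 1+η(t) with η(t)→0 as t→∞, i.e. as asymptotic equivalence; exact equality with o(1) only inside the integral fails, for example when r is continuous but not locally Lipschitz for large t. *)

(* Defs.v *)
From HB Require Import structures.
From mathcomp Require Import all_boot all_order all_algebra.
From mathcomp Require Import all_classical all_reals all_analysis.

Set Implicit Arguments.
Unset Strict Implicit.
Unset Printing Implicit Defensive.

Import Order.TTheory GRing.Theory Num.Theory.
Import numFieldNormedType.Exports.

Local Open Scope classical_set_scope.
Local Open Scope ring_scope.

Definition Phi {R : realType} (alpha u : R) : R :=
  Num.sg u * `|u| `^ (alpha - 1).

(* The difference quotient is restricted to I, so this is the one-sided
   derivative at an endpoint belonging to I. *)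
Definition has_deriv_on {R : realType} (I : set R) (f f' : R -> R) : Prop :=
  forall t, I t -> (f s - f t) / (s - t) @[s --> within I t^'] --> f' t.

Definition C1_on {R : realType} (I : set R) (f f' : R -> R) : Prop :=
  has_deriv_on I f f' /\ {within I, continuous f'}.

(* (r Phi(y'))' = p Phi(y o tau) on I, with y and r Phi(y') of class C^1. *)
Definition solution_on {R : realType} (alpha : R) (r p tau : R -> R)
    (I : set R) (y : R -> R) : Prop :=
  exists y' q' : R -> R,
    [/\ C1_on I y y',
        C1_on I (fun t => r t * Phi alpha (y' t)) q' &
        forall t, I t -> q' t = p t * Phi alpha (y (tau t))].

(* Functions are total, but membership in the classes below depends only on
   the values for large t.  In particular t0 may be enlarged, so it does not
   matter that y (tau t) may be evaluated to the left of t0 for t near t0. *)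
Definition Ssol {R : realType} (alpha a : R) (r p tau : R -> R) :
    set (R -> R) :=
  [set y : R -> R | exists t0 : R, [/\ a <= t0, solution_on alpha r p tau `[t0, +oo[ y &
                          forall t, t0 <= t -> 0 < y t]].

Definition ISsol {R : realType} (alpha a : R) (r p tau : R -> R) :
    set (R -> R) :=
  [set y : R -> R | Ssol alpha a r p tau y /\ \forall t \near +oo, 0 < derive1 y t].

(* For a solution on [t0, +oo[ the two-sided derivative used here exists for
   every t > t0, which suffices for statements about large t. *)
Definition quasi {R : realType} (alpha : R) (r y : R -> R) (t : R) : R :=
  r t * Phi alpha (derive1 y t).

Variant limit_kind := Bnd | Infty.

Definition has_limit_kind {R : realType} (k : limit_kind) (f : R -> R) : Prop :=
  match k with
  | Bnd => exists l : R, l != 0 /\ f t @[t --> +oo] --> l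
  | Infty => f t @[t --> +oo] --> +oo
  end.

Definition ISuv {R : realType} (alpha a : R) (r p tau : R -> R)
    (u v : limit_kind) : set (R -> R) :=
  [set y : R -> R | [/\ ISsol alpha a r p tau y, has_limit_kind u y &
               has_limit_kind v (quasi alpha r y)]].

Definition RV {R : realType} (theta : R) : set (R -> R) :=
  [set f : R -> R | (exists t0 : R, measurable_fun `[t0, +oo[ f /\
                       forall t, t0 <= t -> 0 < f t) /\
           forall lambda, 0 < lambda ->
             f (lambda * t) / f t @[t --> +oo] --> lambda `^ theta].

Definition SV {R : realType} : set (R -> R) := RV 0.

Definition Lpart {R : realType} (theta : R) (f : R -> R) (t : R) : R :=
  f t / t `^ theta.

(* The integrability clause makes the integral in the representation
   meaningful; it is not automatic from psi --> 0 on initial segments. *)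
Definition NRV {R : realType} (theta : R) : set (R -> R) :=
  [set f : R -> R | exists (t0 C : R) (psi : R -> R),
    [/\ 0 < t0, 0 < C, measurable_fun `[t0, +oo[ psi,
        psi t @[t --> +oo] --> 0 &
        forall t, t0 <= t ->
          lebesgue_measure.-integrable `[t0, t] (fun s => (psi s / s)%:E) /\
          f t = C * t `^ theta *
            expR (\int[lebesgue_measure]_(s in `[t0, t]) (psi s / s))]].

Definition Pi_class {R : realType} (w : R -> R) : set (R -> R) :=
  [set f : R -> R | [/\ (exists t0 : R, measurable_fun `[t0, +oo[ f),
               \forall t \near +oo, 0 < w t &
               forall lambda, 0 < lambda ->
                 (f (lambda * t) - f t) / w t @[t --> +oo] --> ln lambda]].

Definition S_RV {R : realType} (alpha a : R) (r p tau : R -> R) (theta : R) :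
  set (R -> R) := Ssol alpha a r p tau `&` RV theta.

Definition S_NRV {R : realType} (alpha a : R) (r p tau : R -> R) (theta : R) :
  set (R -> R) := Ssol alpha a r p tau `&` NRV theta.

Definition Htau {R : realType} (alpha : R) (r p tau tau' : R -> R) (t : R) : R :=
  (t * tau' t) `^ (alpha - 1) * (p t / r (tau t)).

(* y(t) = t r^(1-beta)(t) exp(int_T^t (1+o(1)) (beta-1)/Phi(rho) H(s) ds),
   read as an asymptotic equality for t -> +oo.  Identity without the factor
   1 + eta would fail whenever r is continuous but not locally Lipschitz for
   large t, since y and the exponential factor are locally Lipschitz. *)
Definition formula_infinite {R : realType} (alpha beta rho T : R)
    (r H y : R -> R) : Prop :=
  exists eps eta : R -> R,
    [/\ eps s @[s --> +oo] --> 0,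
        eta t @[t --> +oo] --> 0,
        forall t, T <= t -> lebesgue_measure.-integrable `[T, t]
          (fun s => ((1 + eps s) * ((beta - 1) / Phi alpha rho) * H s)%:E) &
        \forall t \near +oo,
          y t = (1 + eta t) * (t * r t `^ (1 - beta) *
            expR (\int[lebesgue_measure]_(s in `[T, t])
              ((1 + eps s) * ((beta - 1) / Phi alpha rho) * H s)))].

Definition formula_finite {R : realType} (alpha beta rho T M : R)
    (r H y : R -> R) : Prop :=
  exists (A : R) (eps : R -> R),
    let h xi := (1 + eps xi) * ((beta - 1) / rho `^ (alpha - 1)) * H xi in
    let g s := M `^ (beta - 1) * r s `^ (1 - beta) *
      expR (- \int[lebesgue_measure]_(xi in `[s, +oo[) h xi) in
    [/\ eps xi @[xi --> +oo] --> 0,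
        lebesgue_measure.-integrable `[T, +oo[ (fun xi => (h xi)%:E),
        forall t, T <= t ->
          lebesgue_measure.-integrable `[T, t] (fun s => (g s)%:E) &
        \forall t \near +oo,
          y t = A + \int[lebesgue_measure]_(s in `[T, t]) g s].

(* Main.v *)
(* With q = r Phi(y') and z = y o tau, an increasing solution satisfies
   q' = p z^(alpha - 1) and z' = q(tau)^(beta - 1) g, where
   g = r(tau)^(1 - beta) tau' is regularly varying of index rho - 1.
   Monotonicity of q and Karamata's theorem for a primitive of g bound z by a
   multiple of q^(beta - 1) t g, hence t q'/q by a multiple of t H(t).  The
   limit hypothesis on L_p / L_r, together with uniform convergence for the slowly
   varying factor of r (t / tau is bounded), gives t H(t) -> 0.  So q is
   slowly varying, y' = q^(beta - 1) r^(1 - beta) has index rho - 1, and Karamata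
   yields t y'/y -> rho and t z'/z -> rho.  The latter sharpens the bound to
   q'/q ~ H / rho^(alpha - 1) and makes q' regularly varying of index -1.
   Integrating q'/q gives the two formulae; the behaviour of q and of M - q
   follows from q' in RV(-1) by de Haan's theorem. *)

Require Import Defs.
From HB Require Import structures.
From mathcomp Require Import all_boot all_order all_algebra.
From mathcomp Require Import all_classical all_reals all_analysis.
From mathcomp Require Import measurable_realfun ring lra.

Set Implicit Arguments.
Unset Strict Implicit.
Unset Printing Implicit Defensive.

Import Order.TTheory GRing.Theory Num.Theory.
Import numFieldNormedType.Exports.

Local Open Scope classical_set_scope.
Local Open Scope ring_scope.

(** * Uniform convergence *)

Section uniform_convergence.
Context {R : realType}.
Implicit Types f : R -> R.

(** The obstacle is a circle: the sharp size of [z] needs [q] slowly varying, while slow variation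
    of [q] is read off [q' / q], which contains [z]. It is broken by a crude one-sided bound of [z]
    in which [q] enters only through its monotonicity; exact constants come in a second pass. Most
    estimates avoid integrals: increments are compared, by Cauchy's mean value theorem, with those
    of a power, of the logarithm or of a known primitive. Karamata's theorem and the de Haan limits
    arise in this way, the main input being uniform convergence for continuous slowly varying
    functions, proved by Baire category. In the two formulae the lower limit is prescribed, whereas
    the differential relations hold only for large arguments; since [o(1)] is restricted only at
    infinity, its values on a bounded initial interval are chosen so that the constants come out
    right. Equality of the solution classes also needs a converse: a solution of positive index
    increases, because monotonicity of [r Phi(y')] gives [y'] an eventual sign. *)

Lemma eventually_exists (P : R -> Prop) : (\forall x \near +oo, P x) ->
  exists X, forall x, X <= x -> P x.
Proof.
move=> [X [_ H]]; exists (X + 1) => x Xx; apply: H.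
by rewrite (lt_le_trans _ Xx)// ltrDl.
Qed.

Lemma eventually_forall_ge (P : R -> Prop) : (\forall x \near +oo, P x) ->
  \forall x \near +oo, forall y, x <= y -> P y.
Proof.
move=> /eventually_exists[X H]; exists X; split; first exact: num_real.
by move=> x Xx y xy; apply: H; rewrite (le_trans (ltW Xx)).
Qed.

(** Two increments of [f] from a common base point differ by an increment of [f]. An interval of
    shifts on which all increments from far base points are at most [e / 2] therefore gives
    uniformity over small shifts. *)
Lemma uniform_convergence_additive_small f :
  (\forall x \near +oo, {for x, continuous f}) ->
  (forall u : R, 0 <= u -> f (x + u) - f x @[x --> +oo] --> 0) ->
  forall e : R, 0 < e -> exists2 d : R, 0 < d &
    \forall x \near +oo, forall u : R, 0 <= u <= d -> `|f (x + u) - f x| <= e.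
Proof.
move=> /eventually_exists[X cf] f0 e e0.
(* By Baire, one of the closed sets E n, which cover R, contains an interval. *)
pose E (n : nat) := \bigcap_(x in [set x | Num.max X n%:R <= x])
  (fun u : R => f (x + `|u|) - f x) @^-1` [set z | `|z| <= e / 2].
have closedE n : closed (E n).
  apply: closed_bigI => x; rewrite /mkset /= ge_max => /andP[Xx _].
  apply: closed_comp => [u _|].
    apply: continuousB; last exact: cst_continuous.
    apply: (@continuous_comp _ _ _ (fun u : R => x + `|u|) f).
      by apply: cvgD; [exact: cvg_cst|exact: norm_continuous].
    by apply: cf; rewrite (le_trans Xx)// lerDl.
  apply: (@closed_comp _ _ (fun z : R => `|z|) [set z | z <= e / 2]).
    by move=> z _; exact: norm_continuous.
  exact: closed_le.
(* The absolute value in [E] lets limits along nonnegative shifts cover the whole line, where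
   Baire's theorem applies. *)
have coverE u : exists n, E n u.
  have /cvgr0Pnorm_le /(_ (e / 2)) := f0 `|u| (normr_ge0 _).
  rewrite divr_gt0// => /(_ isT) /eventually_exists[Y HY].
  exists (Num.truncn `|Y|).+1 => x /=; rewrite ge_max => /andP[_ nx].
  apply: HY; rewrite (le_trans (ler_norm _))// (le_trans _ nx)//.
  by rewrite ltW// truncnS_gt.
have [n /existsNP[V /not_implyP[[u0 Ou0] /not_implyP[openO OE]]]] :
    exists n, ~ dense (~` E n).
  apply/existsNP => dE.
  have /(_ setT) : dense (\bigcap_i ~` E i).
    by apply: Baire => i; split => //; exact: closed_openC.
  have T0 : (@setT R) !=set0 by exists 0.
  move=> /(_ T0 openT)[u [_ Eu]].
  have [m Em] := coverE u.
  exact: Eu Em.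
have {OE} OE u : V u -> E n u.
  move=> Ou; apply: contrapT => Eu; apply: OE.
  by exists u.
have /nbhs_ballP[d /= d0 dO] : nbhs u0 V by apply: open_nbhs_nbhs; split.
have Ec (v : R) : 0 <= v -> v <= d / 2 -> E n (`|u0| + v).
  move=> v0 vd.
  have vd' : `|v| < d by rewrite ger0_norm//; lra.
  have [u00|u00] := leP 0 u0.
    apply: OE; apply: dO.
    by rewrite /ball/= (ger0_norm u00) opprD addrA subrr sub0r normrN.
  have : E n (u0 - v).
    by apply: OE; apply: dO; rewrite /ball/= opprB addrCA subrr addr0.
  rewrite /E /bigcap /= => H x /H.
  rewrite (ltr0_norm u00) -(normrN (u0 - v)).
  by have -> : - (u0 - v) = - u0 + v by lra.
exists (d / 2); first by rewrite divr_gt0.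
near=> x => u /andP[u0' ud].
(* Seen from the base point [x - |u0|], the shifts [|u0|] and [|u0| + u] lead to [x] and [x + u]. *)
have nx : Num.max X n%:R <= x - `|u0|.
  rewrite lerBrDr; near: x.
  by apply: nbhs_pinfty_ge; rewrite num_real.
have H1 := Ec u u0' ud _ nx.
have H0 : E n (`|u0| + 0) by apply: Ec => //; lra.
move: (H0 _ nx) H1 => /=.
rewrite addr0 normr_id (ger0_norm (addr_ge0 (normr_ge0 u0) u0')).
rewrite addrA subrK => h0 h1.
have -> : f (x + u) - f x =
  (f (x + u) - f (x - `|u0|)) - (f x - f (x - `|u0|)) by lra.
rewrite (le_trans (ler_normB _ _))// (splitr e) lerD//.
Unshelve. all: end_near. Qed.

(** Intervals of length [d] are chained: a shift beyond [k d] is the fixed shift [k d], controlled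
    by the pointwise limit, followed by a shift of at most [d] from the point [x + k d]. *)
Lemma uniform_convergence_additive f :
  (\forall x \near +oo, {for x, continuous f}) ->
  (forall u : R, 0 <= u -> f (x + u) - f x @[x --> +oo] --> 0) ->
  forall L e : R, 0 < e ->
    \forall x \near +oo, forall u : R, 0 <= u <= L -> `|f (x + u) - f x| <= e.
Proof.
move=> cf f0 L e e0.
have e20 : 0 < e / 2 by rewrite divr_gt0.
have [d d0 Hd] := uniform_convergence_additive_small cf f0 e20.
suff H (k : nat) : \forall x \near +oo,
    forall u : R, 0 <= u <= k%:R * d -> `|f (x + u) - f x| <= e.
  have := H (Num.truncn `|L / d|).+1.
  apply: filterS => x Hx u /andP[u0 uL]; apply: Hx; rewrite u0/=.
  rewrite (le_trans uL)// -ler_pdivrMr// (le_trans (ler_norm _))//.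
  by rewrite ltW// truncnS_gt.
elim: k => [|k IH].
  near=> x => u; rewrite mul0r => /andP[u0 u0'].
  have -> : u = 0 by apply/eqP; rewrite eq_le u0 u0'.
  by rewrite addr0 subrr normr0 ltW.
have kd0 : 0 <= k%:R * d by rewrite mulr_ge0// ltW.
have /cvgr0Pnorm_le /(_ _ e20) Hk := f0 _ kd0.
near=> x => u /andP[u0 uk].
have [uk'|uk'] := leP u (k%:R * d).
  have H : forall u : R, 0 <= u <= k%:R * d -> `|f (x + u) - f x| <= e.
    by near: x.
  by apply: H; rewrite u0.
have H1 : `|f (x + k%:R * d) - f x| <= e / 2 by near: x.
have H2 : forall y, x <= y -> forall v, 0 <= v <= d -> `|f (y + v) - f y| <= e / 2.
  by near: x; exact: eventually_forall_ge.
have := H2 (x + k%:R * d) _ (u - k%:R * d).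
rewrite lerDl kd0 => /(_ isT).
have -> : x + k%:R * d + (u - k%:R * d) = x + u by lra.
move: uk; rewrite -natr1 mulrDl mul1r => uk.
have -> : 0 <= u - k%:R * d <= d by lra.
move=> /(_ isT) H3.
have -> : f (x + u) - f x = (f (x + u) - f (x + k%:R * d)) +
   (f (x + k%:R * d) - f x) by lra.
rewrite (le_trans (ler_normD _ _))// (splitr e) lerD//.
Unshelve. all: end_near. Qed.

End uniform_convergence.

(** * Limits at infinity *)

Section asymptotics.
Context {R : realType}.
Implicit Types f g h : R -> R.

Lemma cvg_near_eq f g (l : R) : (\forall t \near +oo, f t = g t) ->
  f t @[t --> +oo] --> l -> g t @[t --> +oo] --> l.
Proof. by move=> fg; apply: cvg_trans; exact: near_eq_cvg. Qed.

Lemma cvg_scale (l : R) : 0 < l -> l * t @[t --> +oo] --> +oo.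
Proof. by move=> l0; apply: gt0_cvgMry => //; exact: cvg_id. Qed.

Lemma near_scale (P : R -> Prop) (l : R) : 0 < l ->
  (\forall t \near +oo, P t) -> \forall t \near +oo, P (l * t).
Proof. by move=> l0 HP; exact: cvg_scale l0 _ HP. Qed.

Lemma near_comp (P : R -> Prop) f : f t @[t --> +oo] --> +oo ->
  (\forall t \near +oo, P t) -> \forall t \near +oo, P (f t).
Proof. by move=> ly HP; exact: ly _ HP. Qed.

Lemma cvg_comp_pinfty f g (l : R) : g t @[t --> +oo] --> +oo ->
  f t @[t --> +oo] --> l -> f (g t) @[t --> +oo] --> l.
Proof. by move=> gy fl; exact: (cvg_comp g f gy fl). Qed.

Lemma cvgyM f g (a b : R) : f t @[t --> +oo] --> a -> g t @[t --> +oo] --> b ->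
  f t * g t @[t --> +oo] --> a * b.
Proof. by move=> fa gb; exact: cvgM. Qed.

Lemma cvgyB f g (a b : R) : f t @[t --> +oo] --> a -> g t @[t --> +oo] --> b ->
  f t - g t @[t --> +oo] --> a - b.
Proof. by move=> fa gb; exact: cvgB. Qed.

Lemma cvgyV f (a : R) : a != 0 -> f t @[t --> +oo] --> a ->
  (f t)^-1 @[t --> +oo] --> a^-1.
Proof. by move=> a0 fa; exact: cvgV. Qed.

Lemma cvgy_cst (a : R) : (fun=> a) t @[t --> (+oo : set_system R)] --> a.
Proof. exact: cvg_cst. Qed.

Lemma near_cvg_gt f (c l : R) : f t @[t --> +oo] --> l -> c < l ->
  \forall t \near +oo, c < f t.
Proof. by move=> fl cl; exact: (cvgr_gt _ fl _ cl). Qed.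

Lemma near_cvg_lt f (c l : R) : f t @[t --> +oo] --> l -> l < c ->
  \forall t \near +oo, f t < c.
Proof. by move=> fl cl; exact: (cvgr_lt _ fl _ cl). Qed.

Lemma continuous_powR (c x : R) : 0 < x -> {for x, continuous (fun z => z `^ c)}.
Proof.
move=> x0; apply: differentiable_continuous; apply/derivable1_diffP.
exact: (@ex_derive _ _ _ _ _ _ _ (is_derive1_powR c x0)).
Qed.

Lemma cvg_powR {F : set_system R} {FF : Filter F} f (c l : R) : 0 < l ->
  f t @[t --> F] --> l -> f t `^ c @[t --> F] --> l `^ c.
Proof.
move=> l0 fl; apply: (cvg_comp f (fun z => z `^ c) fl).
exact: continuous_powR.
Qed.

Lemma powR_div (x y c : R) : 0 < x -> 0 < y -> (x / y) `^ c = x `^ c / y `^ c.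
Proof.
move=> x0 y0; rewrite powRM ?(ltW x0) ?invr_ge0 ?(ltW y0)//.
by rewrite -powR_inv1 ?(ltW y0)// -powRrM mulN1r powRN.
Qed.

Lemma is_derive_continuous f (x d : R) : is_derive x 1 f d -> {for x, continuous f}.
Proof.
move=> fd; apply: differentiable_continuous; apply/derivable1_diffP.
exact: (@ex_derive _ _ _ _ _ _ _ fd).
Qed.

Lemma within_is_derive f g (a b : R) :
  (forall x, a <= x -> is_derive x 1 f (g x)) ->
  {within `[a, b], continuous f}.
Proof.
move=> fg; apply: derivable_within_continuous => x.
rewrite in_itv/= => /andP[ax _].
exact: (@ex_derive _ _ _ _ _ _ _ (fg x ax)).
Qed.

Lemma pos_derive_increasing f g (c : R) :
  (forall x, c <= x -> is_derive x 1 f (g x)) -> (forall x, c <= x -> 0 < g x) ->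
  forall x y, c <= x -> x < y -> f x < f y.
Proof.
move=> fg g0 x y cx xy.
have [w|| z] := @MVT _ f g _ _ xy.
- by rewrite in_itv/= => /andP[xz _]; apply: fg; rewrite (le_trans cx)// ltW.
- by apply: within_is_derive => z' xz; apply: fg; exact: le_trans cx xz.
rewrite in_itv/= => /andP[xz _] fxy.
rewrite -subr_gt0 fxy mulr_gt0 ?subr_gt0//.
by rewrite g0// (le_trans cx)// ltW.
Qed.

Lemma nneg_derive_nondecreasing f g (c : R) :
  (forall x, c <= x -> is_derive x 1 f (g x)) -> (forall x, c <= x -> 0 <= g x) ->
  forall x y, c <= x -> x <= y -> f x <= f y.
Proof.
move=> fg g0 x y cx xy.
have [w|| z] := @MVT_segment _ f g _ _ xy.
- by rewrite in_itv/= => /andP[xz _]; apply: fg; rewrite (le_trans cx)// ltW.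
- by apply: within_is_derive => z' xz; apply: fg; exact: le_trans cx xz.
rewrite in_itv/= => /andP[xz _] fxy.
rewrite -subr_ge0 fxy mulr_ge0 ?subr_ge0//.
by rewrite g0// (le_trans cx).
Qed.

(** Used in place of integrals: an increment of [f] is measured by that of a comparison function [g]
    whose growth is explicit. *)
Lemma cauchy_mean_value f g (f' g' : R -> R) (c : R) :
  (forall x, c <= x -> is_derive x 1 f (f' x)) ->
  (forall x, c <= x -> is_derive x 1 g (g' x)) ->
  (forall x, c <= x -> g' x != 0) ->
  forall x y, c <= x -> x < y ->
  exists2 z, x <= z <= y & f y - f x = f' z / g' z * (g y - g x).
Proof.
move=> ff gg g0 x y cx xy.
have cf := @within_is_derive f f' x y (fun z xz => ff z (le_trans cx xz)).
have cg := @within_is_derive g g' x y (fun z xz => gg z (le_trans cx xz)).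
have dom z : z \in `]x, y[ -> c <= z.
  by rewrite in_itv/= => /andP[xz _]; rewrite (le_trans cx)// ltW.
have df z : z \in `]x, y[ -> is_derive z 1 f (f' z) by move/dom/ff.
have dg z : z \in `]x, y[ -> is_derive z 1 g (g' z) by move/dom/gg.
have dg0 z : z \in `]x, y[ -> g' z != 0 by move/dom/g0.
have [z zxy fg] := cauchy_MVT xy cf cg df dg dg0.
exists z; first by move: zxy; rewrite in_itv/= => /andP[? ?]; rewrite !ltW.
by rewrite fg divfK// (differentiable_subr_neq0 xy cg dg dg0).
Qed.

(** Between a fixed [c] and [x] the increments of [f] and [g] have a ratio close to [l]; the initial
    values at [c] are negligible because [g] is unbounded. *)
Lemma lhopital_pinfty f g (f' g' : R -> R) (l : R) :
  (\forall x \near +oo, is_derive (x : R) 1 f (f' x)) ->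
  (\forall x \near +oo, is_derive (x : R) 1 g (g' x)) ->
  (\forall x \near +oo, 0 < g' x) ->
  g x @[x --> +oo] --> +oo ->
  f' x / g' x @[x --> +oo] --> l -> f x / g x @[x --> +oo] --> l.
Proof.
move=> df dg g0 gy fgl; apply/cvgrPdistC_le => e e0.
have e20 : 0 < e / 2 by rewrite divr_gt0.
have /cvgrPdistC_le /(_ _ e20) He := fgl.
have /cvgryPge /(_ 0) gge0 := gy.
have [c Hc] : exists c : R, forall x : R, c <= x -> [/\ is_derive x 1 f (f' x),
    is_derive x 1 g (g' x), 0 < g' x, `|f' x / g' x - l| <= e / 2 & 0 <= g x].
  apply: eventually_exists; near=> x.
  by split; near: x.
have gc0 : 0 <= g c by have [] := Hc _ (lexx c).
(* Beyond this threshold [|f c - l * g c|] is at most [e / 2 * g x]. *)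
have /cvgryPge /(_ (Num.max 1 (`|f c - l * g c| / (e / 2)))) Hg := gy.
near=> x.
have cx : c < x by near: x; apply: nbhs_pinfty_gt; rewrite num_real.
have : Num.max 1 (`|f c - l * g c| / (e / 2)) <= g x by near: x.
rewrite ge_max => /andP[gx1]; rewrite ler_pdivrMr// => gxc.
have gx0 : 0 < g x by exact: lt_le_trans gx1.
have [|||z /andP[cz _] fcx] := @cauchy_mean_value f g f' g' c _ _ _ c x (lexx c) cx.
- by move=> y /Hc[].
- by move=> y /Hc[].
- by move=> y /Hc[_ _ /gt_eqF ->].
have [_ _ _ Hz _] := Hc z cz.
have gcx : g c <= g x.
  apply: (@nneg_derive_nondecreasing g g' c) (lexx c) (ltW cx).
    by move=> y /Hc[].
  by move=> y /Hc[_ _ /ltW].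
have -> : f x / g x - l = (f x - l * g x) / g x.
  by field; rewrite gt_eqF.
rewrite normrM normfV (gtr0_norm gx0) ler_pdivrMr//.
have -> : f x - l * g x = (f c - l * g c) + (f' z / g' z - l) * (g x - g c).
  by rewrite mulrBl -fcx; ring.
rewrite (le_trans (ler_normD _ _))// normrM (ger0_norm (x := g x - g c)) ?subr_ge0//.
have -> : e * g x = g x * (e / 2) + e / 2 * g x by field.
by rewrite lerD// ler_pM// ?subr_ge0// lerBlDr lerDl.
Unshelve. all: end_near. Qed.

Lemma lhopital_pinfty_zero f g (f' g' : R -> R) (l : R) :
  (\forall x \near +oo, is_derive (x : R) 1 f (f' x)) ->
  (\forall x \near +oo, is_derive (x : R) 1 g (g' x)) ->
  (\forall x \near +oo, g' x < 0) ->
  f x @[x --> +oo] --> 0 -> g x @[x --> +oo] --> 0 ->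
  f' x / g' x @[x --> +oo] --> l -> f x / g x @[x --> +oo] --> l.
Proof.
move=> df dg g0 fo go fgl; apply/cvgrPdistC_le => e e0.
have /cvgrPdistC_le /(_ _ e0) He := fgl.
have [c Hc] : exists c : R, forall x : R, c <= x -> [/\ is_derive x 1 f (f' x),
    is_derive x 1 g (g' x), g' x < 0 & `|f' x / g' x - l| <= e].
  apply: eventually_exists; near=> x.
  by split; near: x.
have dec x y : c <= x -> x < y -> g y < g x.
  move=> cx xy; rewrite -ltrN2.
  apply: (@pos_derive_increasing (fun x => - g x) (fun x => - g' x) c) => //.
    by move=> z /Hc[_ dgz _ _]; exact: is_deriveN.
  by move=> z /Hc[_ _ ? _]; rewrite oppr_gt0.
have gpos x : c <= x -> 0 < g x.
  move=> cx; rewrite (@le_lt_trans _ _ (g (x + 1)))//; last first.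
    by rewrite dec// ltrDl.
  apply: (cvgr_to_le go); near=> s.
  have xs : x + 1 < s by near: s; apply: nbhs_pinfty_gt; rewrite num_real.
  by rewrite ltW// dec//; lra.
near=> x.
have cx : c <= x by near: x; apply: nbhs_pinfty_ge; rewrite num_real.
have gx0 := gpos x cx.
have -> : f x / g x - l = (f x - l * g x) / g x by field; rewrite gt_eqF.
rewrite normrM normfV (gtr0_norm gx0) ler_pdivrMr// -subr_le0.
(* The mean value estimate on [[x, s]] is kept as one inequality, so that letting [s] tend to
   infinity removes [f s] and [g s]. *)
have lim : `|f x - l * g x - (f s - l * g s)| - e * (g x - g s) @[s --> +oo] -->
    `|f x - l * g x - (0 - l * 0)| - e * (g x - 0).
  apply: cvgB.
    apply: cvg_norm; apply: cvgB; first exact: cvg_cst.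
    by apply: cvgB => //; apply: cvgMr.
  by apply: cvgMr; apply: cvgB => //; exact: cvg_cst.
rewrite mulr0 !subr0 in lim.
apply: (cvgr_to_le lim); near=> s.
have xs : x < s by near: s; apply: nbhs_pinfty_gt; rewrite num_real.
have [|||z /andP[xz _] fcx] := @cauchy_mean_value f g f' g' c _ _ _ x s cx xs.
- by move=> y /Hc[].
- by move=> y /Hc[].
- by move=> y /Hc[_ _ /lt_eqF ->].
have [_ _ _ Hz] := Hc z (le_trans cx xz).
have gxs := dec _ _ cx xs.
have -> : f x - l * g x - (f s - l * g s) = (f' z / g' z - l) * (g x - g s).
  by rewrite mulrBl -[g x - g s]opprB mulrN -fcx; ring.
rewrite normrM (gtr0_norm (x := g x - g s)) ?subr_gt0// subr_le0.
by rewrite ler_pM2r// subr_gt0.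
Unshelve. all: end_near. Qed.

End asymptotics.
Arguments cvgy_cst {R} a.

(** * Regular variation *)

Section regular_variation.
Context {R : realType}.
Implicit Types f g h F : R -> R.

(* Unlike RV, without measurability. *)
Definition regularly_varying (theta : R) f :=
  (\forall t \near +oo, 0 < f t) /\
  forall l : R, 0 < l -> f (l * t) / f t @[t --> +oo] --> l `^ theta.

Lemma regularly_varying_eq (theta : R) f g : (\forall t \near +oo, f t = g t) ->
  regularly_varying theta f -> regularly_varying theta g.
Proof.
move=> fg [f0 fl]; split; first by near=> t; rewrite -(near fg t)//; near: t.
move=> l l0; apply: cvg_near_eq (fl l l0); have fgl := near_scale l0 fg.
by near=> t; rewrite (near fg t)// (near fgl t).
Unshelve. all: end_near. Qed.

Lemma regularly_varying_powR_id (theta : R) :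
  regularly_varying theta (fun t => t `^ theta).
Proof.
split; first by near=> t; rewrite powR_gt0.
move=> l l0; apply: cvg_near_eq (cvg_cst _); near=> t.
have t0 : 0 < t by [].
by rewrite powRM ?ltW// mulfK// gt_eqF// powR_gt0.
Unshelve. all: end_near. Qed.

Lemma regularly_varyingM (theta eta : R) f g : regularly_varying theta f ->
  regularly_varying eta g -> regularly_varying (theta + eta) (fun t => f t * g t).
Proof.
move=> [f0 fl] [g0 gl]; split.
  by near=> t; rewrite mulr_gt0//; near: t.
move=> l l0; rewrite powRD; last by rewrite (gt_eqF l0) implybT.
apply: cvg_near_eq (cvgyM (fl l l0) (gl l l0)); near=> t.
have ft : 0 < f t by near: t.
have gt : 0 < g t by near: t.
by rewrite /=; field; rewrite !gt_eqF.
Unshelve. all: end_near. Qed.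

Lemma regularly_varying_powR (theta c : R) f : regularly_varying theta f ->
  regularly_varying (theta * c) (fun t => f t `^ c).
Proof.
move=> [f0 fl]; split; first by apply: filterS f0 => t; exact: powR_gt0.
move=> l l0; rewrite powRrM.
have H : (f (l * t) / f t) `^ c @[t --> +oo] --> (l `^ theta) `^ c.
  exact: cvg_powR (powR_gt0 theta l0) (fl l l0).
apply: cvg_near_eq H; have f0l := near_scale l0 f0; near=> t.
by rewrite powR_div//; near: t.
Unshelve. all: end_near. Qed.

Lemma regularly_varying_equiv (theta c : R) f g : 0 < c ->
  regularly_varying theta f -> g t / f t @[t --> +oo] --> c ->
  regularly_varying theta g.
Proof.
move=> c0 [f0 fl] gf; have gf0 := near_cvg_gt gf c0.
have g0 : \forall t \near +oo, 0 < g t.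
  near=> t; have : 0 < g t / f t by near: t.
  by rewrite pmulr_lgt0// invr_gt0; near: t.
split => // l l0.
have gfl := cvg_comp_pinfty (cvg_scale l0) gf.
have := cvgyM (cvgyM gfl (cvgyV (lt0r_neq0 c0) gf)) (fl l l0).
rewrite mulfV ?gt_eqF// mul1r; apply: cvg_near_eq.
have f0l := near_scale l0 f0.
near=> t.
have ft : 0 < f t by near: t.
have gt : 0 < g t by near: t.
have ftl : 0 < f (l * t) by near: t.
by rewrite /=; field; rewrite !gt_eqF.
Unshelve. all: end_near. Qed.

(** The substitution [F x = ln (f (expR x))] turns multiplicative shifts [s / t] in [[1, K]] into
    additive shifts in [[0, ln K]]. *)
Lemma slowly_varying_uniform f (K e : R) :
  (\forall t \near +oo, {for t, continuous f}) -> regularly_varying 0 f ->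
  0 < e ->
  \forall t \near +oo, forall s, t <= s <= K * t -> `|f s / f t - 1| <= e.
Proof.
move=> cf [f0 fl] e0.
have expy : @expR R t @[t --> +oo] --> +oo.
  apply/cvgryPge => A; near=> t.
  have : `|A| <= t by near: t; apply: nbhs_pinfty_ge; rewrite num_real.
  move=> At; rewrite (le_trans (ler_norm A))// (le_trans At)//.
  by rewrite (le_trans _ (expR_ge1Dx _))// lerDr.
have lny : @ln R t @[t --> +oo] --> +oo.
  apply/cvgryPge => A; near=> t.
  have : expR A <= t by near: t; apply: nbhs_pinfty_ge; rewrite num_real.
  move=> At; have t0 : 0 < t by rewrite (lt_le_trans _ At)// expR_gt0.
  by rewrite -[A]expRK ler_ln// posrE expR_gt0.
pose F (x : R) := ln (f (expR x)).
have cF : \forall x \near +oo, {for x, continuous F}.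
  have cfe := near_comp expy cf.
  have f0e := near_comp expy f0.
  near=> x; apply: continuous_comp.
    apply: continuous_comp; first exact: continuous_expR.
    by near: x.
  by apply: continuous_ln; near: x.
have Fu u : 0 <= u -> F (x + u) - F x @[x --> +oo] --> 0.
  move=> _; have u0 := expR_gt0 u.
  have := cvg_comp_pinfty expy (fl _ u0); rewrite powRr0 => H.
  have : ln (f (expR u * expR t) / f (expR t)) @[t --> +oo] --> @ln R 1.
    by apply: (cvg_comp _ _ H); apply: continuous_ln.
  rewrite ln1; apply: cvg_near_eq.
  have f0e := near_comp expy f0.
  have f0eu := near_comp expy (near_scale u0 f0).
  near=> x.
  have fx : 0 < f (expR x) by near: x.
  have fux : 0 < f (expR u * expR x) by near: x.
  by rewrite /F ln_div ?posrE// expRD [expR u * _]mulrC.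
(* Continuity of the exponential at 0 converts smallness of the logarithm of [f s / f t] into
   closeness of that ratio to 1. *)
have [d d0 Hd] : exists2 d : R, 0 < d &
    forall w, `|w| <= d -> `|expR w - 1| <= e.
  have /cvgrPdistC_le /(_ _ e0) := @continuous_expR R 0.
  rewrite expR0 => /nbhs_ballP[d /= d0 Hd]; exists (d / 2).
    by rewrite divr_gt0.
  move=> w wd; apply: Hd; rewrite /ball/= sub0r normrN.
  by rewrite (le_lt_trans wd)// ltr_pdivrMr// ltr_pMr// ltr1n.
have uF := uniform_convergence_additive cF Fu (ln K) d0.
have uFl := near_comp lny uF.
have f0ge := eventually_forall_ge f0.
near=> t => s /andP[ts sK].
have t0 : 0 < t by [].
have s0 : 0 < s by exact: lt_le_trans ts.
have K0 : 0 < K.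
  by have := lt_le_trans s0 sK; rewrite pmulr_lgt0.
have fs : 0 < f s.
  have H : forall y, t <= y -> 0 < f y by near: t.
  exact: H.
have ft : 0 < f t by near: t.
have H : forall u : R, 0 <= u <= ln K -> `|F (ln t + u) - F (ln t)| <= d.
  by near: t.
have := H (ln s - ln t).
rewrite subr_ge0 ler_ln ?posrE// ts lerBlDr -lnM ?posrE// ler_ln ?posrE ?mulr_gt0//.
rewrite sK [ln t + _]addrC subrK /F !lnK ?posrE// => /(_ isT) /Hd.
by rewrite expRB !lnK ?posrE.
Unshelve. all: end_near. Qed.

(** A slowly varying function does not distinguish arguments of bounded ratio; this is how the delay
    disappears from slowly varying factors. *)
Lemma slowly_varying_comp_equiv f g h (K : R) :
  (\forall t \near +oo, {for t, continuous f}) -> regularly_varying 0 f ->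
  g t @[t --> +oo] --> +oo ->
  (\forall t \near +oo, g t <= h t <= K * g t) ->
  f (h t) / f (g t) @[t --> +oo] --> (1 : R).
Proof.
move=> cf f0 gy gh; apply/cvgrPdistC_le => e e0.
have := near_comp gy (slowly_varying_uniform K cf f0 e0).
by apply: filterS2 gh => t ght; apply.
Qed.

Lemma powR_gt1 (x a : R) : 1 < x -> 0 < a -> 1 < x `^ a.
Proof.
move=> x1 a0; have : 1 `^ a < x `^ a.
  by rewrite gt0_ltr_powR// nnegrE// ltW// (lt_trans _ x1).
by rewrite powR1.
Qed.

Lemma powRD_gt0 (x a b : R) : 0 < x -> x `^ (a + b) = x `^ a * x `^ b.
Proof. by move=> x0; rewrite powRD// (gt_eqF x0) implybT. Qed.

(** The increment of [F] over [[t, l * t]] is that of [g] times [f z / z ^ (s - 1)] at an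
    intermediate [z], and this slowly varying quotient is uniformly close to its value at [t].
    Keeping [g] abstract covers both powers ([s > 0]) and the logarithm ([s = 0]); at [t = 1] one
    sees [c = g l - g 1]. *)
Lemma de_haan f g F (s c l : R) : 1 < l ->
  (\forall t \near +oo, is_derive (t : R) 1 F (f t)) ->
  (\forall t \near +oo, {for t, continuous f}) ->
  regularly_varying (s - 1) f ->
  (forall t : R, 0 < t -> is_derive t 1 g (t `^ (s - 1))) ->
  (forall t : R, 0 < t -> g (l * t) - g t = c * t `^ s) ->
  (F (l * t) - F t) / (t * f t) @[t --> +oo] --> c.
Proof.
move=> l1 Ff cf fs dg gl; have [f0 _] := fs.
pose h t := f t * t `^ (1 - s).
have h0 : regularly_varying 0 h.
  have := regularly_varyingM fs (regularly_varying_powR_id (1 - s)).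
  by have -> : s - 1 + (1 - s) = 0 by ring.
have ch : \forall t \near +oo, {for t, continuous h}.
  near=> t; apply: continuousM; first by near: t.
  by apply: continuous_powR; near: t; apply: nbhs_pinfty_gt; rewrite num_real.
apply/cvgrPdistC_le => e e0.
(* Adding 1 keeps the denominator positive when [c = 0]. *)
have c10 : 0 < `|c| + 1 by rewrite ltr_pwDr.
have ec0 : 0 < e / (`|c| + 1) by rewrite divr_gt0.
have hu := slowly_varying_uniform l ch h0 ec0.
have Ff' := eventually_forall_ge Ff.
near=> t.
have t0 : 0 < t by [].
have ft : 0 < f t by near: t.
have hut : forall s, t <= s <= l * t -> `|h s / h t - 1| <= e / (`|c| + 1).
  by near: t.
have tl : t < l * t by rewrite ltr_pMl.
have [|||z /andP[tz zl]] := @cauchy_mean_value _ F g f (fun t => t `^ (s - 1)) t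
    _ _ _ t (l * t) (lexx t) tl.
- by near: t.
- by move=> x tx; apply: dg; exact: lt_le_trans tx.
- by move=> x tx; rewrite gt_eqF// powR_gt0// (lt_le_trans t0).
rewrite gl// => ->.
have z0 : 0 < z by exact: lt_le_trans tz.
have -> : f z / z `^ (s - 1) * (c * t `^ s) / (t * f t) = c * (h z / h t).
  have -> : t `^ s = t * t `^ (s - 1).
    by rewrite -[X in X * _]powRr1 ?ltW// -powRD_gt0//; congr (_ `^ _); ring.
  rewrite /h -![1 - s]opprB !powRN.
  by field; rewrite !gt_eqF// powR_gt0.
rewrite -[X in _ - X]mulr1 -mulrBr normrM.
rewrite (le_trans (ler_wpM2l (normr_ge0 c) (hut z _))) ?tz//.
by rewrite mulrCA ger_pMr// ler_pdivrMr// mul1r lerDl.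
Unshelve. all: end_near. Qed.

Lemma is_derive_powR_div (s t : R) : s != 0 -> 0 < t ->
  is_derive t 1 (fun x => x `^ s / s) (t `^ (s - 1)).
Proof.
move=> s0 t0; have := is_derive1_powR s t0 => H.
have -> : t `^ (s - 1) = s^-1 *: (s * t `^ (s - 1)) by rewrite /GRing.scale/= mulKf.
have -> : (fun x => x `^ s / s) = s^-1 *: (fun x : R => x `^ s).
  by apply/funext => x; rewrite /GRing.scale/= mulrC.
exact: is_deriveZ.
Qed.

Lemma is_derive_mulrl (c t : R) : is_derive t 1 ( *%R c) c.
Proof.
have -> : ( *%R c) = c *: (@id R) by apply/funext.
by apply: is_derive_eq; rewrite /GRing.scale/= mulr1.
Qed.

Lemma is_derive_scale f (l t d : R) : is_derive (l * t) 1 f d ->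
  is_derive t 1 (fun x => f (l * x)) (l * d).
Proof.
move=> fd.
have H := is_derive_mulrl l t.
by rewrite mulrC; exact: is_derive1_comp.
Qed.

Lemma regularly_varying_primitive_pinfty f F (s : R) : 0 < s ->
  (\forall t \near +oo, is_derive (t : R) 1 F (f t)) ->
  regularly_varying (s - 1) f -> F t @[t --> +oo] --> +oo.
Proof.
move=> s0 Ff [f0 fl].
(* This is where [s > 0] enters: [2 * f (2 * x) - f x], the derivative of [F (2 * x) - F x], is
   eventually positive. *)
have s12 : 2^-1 < 2 `^ (s - 1) :> R.
  rewrite powRD_gt0// powR_inv1// ltr_pMl ?invr_gt0//.
  by rewrite powR_gt1// ltr1n.
have f2 : \forall t \near +oo, 2^-1 < f (2 * t) / f t.
  exact: near_cvg_gt (fl 2 (ltr0Sn _ 1)) s12.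
have Ff2 := near_scale (ltr0Sn R 1) Ff.
have [X HX] : exists X : R, forall t : R, X <= t -> [/\ 0 < t, 0 < f t,
    is_derive t 1 F (f t), is_derive (2 * t) 1 F (f (2 * t)) &
    2^-1 < f (2 * t) / f t].
  apply: eventually_exists; near=> t.
  by split; near: t => //; apply: nbhs_pinfty_gt; rewrite num_real.
have [X0 _ _ _ _] := HX _ (lexx X).
have Fincr := @pos_derive_increasing _ F f X
  (fun x xX => let: And5 _ _ H _ _ := HX x xX in H)
  (fun x xX => let: And5 _ H _ _ _ := HX x xX in H).
have Dincr : forall x y, X <= x -> x < y -> F (2 * x) - F x < F (2 * y) - F y.
  apply: (@pos_derive_increasing _ (fun x => F (2 * x) - F x)
    (fun x => 2 * f (2 * x) - f x)).
    by move=> x /HX[_ _ Fx F2x _]; apply: is_deriveB; exact: is_derive_scale.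
  move=> x /HX[_ fx _ _]; rewrite ltr_pdivlMr// subr_gt0 => H.
  by rewrite -ltr_pdivrMl.
(* F (2 x) - F x increases, so F gains at least d at each doubling. *)
pose d := F (2 * X) - F X.
have d0 : 0 < d by rewrite subr_gt0 Fincr// ltr_pMl// ltr1n.
have X2n n : X <= 2 ^+ n * X by rewrite ler_peMl ?(ltW X0)// exprn_ege1// ler1n.
have HF n : F X + n%:R * d <= F (2 ^+ n * X).
  elim: n => [|n IH]; first by rewrite mul0r addr0 mul1r.
  have : d <= F (2 * (2 ^+ n * X)) - F (2 ^+ n * X).
    have [<-//|neq] := eqVneq X (2 ^+ n * X).
    by rewrite /d ltW// Dincr// lt_neqAle neq X2n.
  by rewrite exprS -mulrA -natr1 mulrDl mul1r; lra.
apply/cvgryPge => A.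
pose n := (Num.truncn (`|A - F X| / d)).+1.
near=> t.
have nt : 2 ^+ n * X < t by near: t; apply: nbhs_pinfty_gt; rewrite num_real.
rewrite (le_trans _ (ltW (Fincr _ _ (X2n n) nt)))// (le_trans _ (HF n))//.
rewrite addrC -lerBlDr (le_trans (ler_norm _))// -ler_pdivrMr//.
by rewrite ltW// truncnS_gt.
Unshelve. all: end_near. Qed.

(** Two limits at the dilation factor 2 are combined: l'Hopital gives [F (2 * t) / F t -> 2 ^ s],
    and [de_haan] gives the limit of [F (2 * t) - F t] relative to [t * f t]. Eliminating the
    doubled value leaves [t * f t / F t]. *)
Lemma karamata f F (s : R) : 0 < s ->
  (\forall t \near +oo, is_derive (t : R) 1 F (f t)) ->
  (\forall t \near +oo, {for t, continuous f}) ->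
  regularly_varying (s - 1) f -> t * f t / F t @[t --> +oo] --> s.
Proof.
move=> s0 Ff cf fs; have [f0 fl] := fs.
have Fy := regularly_varying_primitive_pinfty s0 Ff fs.
have Ff2 := near_scale (ltr0Sn R 1) Ff.
have F0 : \forall t \near +oo, 0 < F t by move/cvgryPgt: Fy; exact.
have F2 : F (2 * t) / F t @[t --> +oo] --> 2 `^ s.
  apply: (@lhopital_pinfty _ _ _ (fun t => 2 * f (2 * t)) f) => //.
    by apply: filterS Ff2 => t; exact: is_derive_scale.
  have -> : 2 `^ s = 2 * 2 `^ (s - 1) :> R.
    by rewrite powRD_gt0// powR_inv1// mulrCA mulfV ?mulr1.
  under eq_fun do rewrite -mulrA.
  by apply: cvgMr; exact: fl.
have s21 : 2 `^ s - 1 != 0 :> R.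
  by rewrite subr_eq0 gt_eqF// powR_gt1// ltr1n.
have D : (F (2 * t) - F t) / (t * f t) @[t --> +oo] --> (2 `^ s - 1) / s.
  apply: (@de_haan f (fun x => x `^ s / s) F s) => //; first by rewrite ltr1n.
    by move=> t t0; apply: is_derive_powR_div; rewrite // gt_eqF.
  by move=> t t0; rewrite powRM// ?ltW//; ring.
have D0 : (2 `^ s - 1) / s != 0 by rewrite mulf_neq0// invr_eq0 gt_eqF.
have := cvgyM (cvgyB F2 (cvgy_cst 1)) (cvgyV D0 D).
have -> : (2 `^ s - 1) * ((2 `^ s - 1) / s)^-1 = s.
  by field; rewrite s21 gt_eqF.
apply: cvg_near_eq.
have D' : \forall t \near +oo, (F (2 * t) - F t) / (t * f t) != 0.
  exact: cvgr_neq0 D D0.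
near=> t.
have Ft : 0 < F t by near: t.
have ft : 0 < f t by near: t.
have t0 : 0 < t by [].
have : (F (2 * t) - F t) / (t * f t) != 0 by near: t.
rewrite mulf_eq0 negb_or => /andP[Dt _].
by field; rewrite Dt !gt_eqF.
Unshelve. all: end_near. Qed.

(** A factor [l < 1] is handled by evaluating the quotient for [l^-1] at [l * t] and inverting
    it. *)
Lemma regularly_varying_gt1 f (s : R) : (\forall t \near +oo, 0 < f t) ->
  (forall l, 1 < l -> f (l * t) / f t @[t --> +oo] --> l `^ s) ->
  regularly_varying s f.
Proof.
move=> f0 fl; split => // l l0; have [l1|l1|<-] := ltgtP 1 l.
- exact: fl.
- have li : 1 < l^-1 by rewrite invf_gt1.
  have := cvg_comp_pinfty (cvg_scale l0) (fl _ li) => H.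
  have lis : l^-1 `^ s != 0 by rewrite gt_eqF// powR_gt0// invr_gt0.
  have := cvgyV lis H.
  have -> : (l^-1 `^ s)^-1 = l `^ s.
    by rewrite -[l^-1]mul1r powR_div// powR1 mul1r invrK.
  apply: cvg_near_eq; near=> t; rewrite mulKf ?gt_eqF//.
  by rewrite invf_div.
- rewrite powR1; apply: cvg_near_eq (cvgy_cst 1); near=> t.
  by rewrite mul1r divff// gt_eqF//; near: t.
Unshelve. all: end_near. Qed.

Lemma normalized_regularly_varying f F (s : R) :
  (\forall t \near +oo, is_derive (t : R) 1 F (f t)) ->
  (\forall t \near +oo, 0 < F t) ->
  t * f t / F t @[t --> +oo] --> s -> regularly_varying s F.
Proof.
move=> Ff F0 lim; apply: regularly_varying_gt1 => // l l1.
have l0 : 0 < l by exact: lt_trans l1.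
have lnl0 : 0 < ln l by rewrite ln_gt0.
suff H : ln (F (l * t) / F t) @[t --> +oo] --> s * ln l.
  rewrite /powR (gt_eqF l0).
  have := cvg_comp _ _ H (@continuous_expR R (s * ln l)).
  apply: cvg_near_eq; have F0l := near_scale l0 F0; near=> t.
  by rewrite /= lnK// posrE divr_gt0//; near: t.
apply/cvgrPdistC_le => e e0.
have el0 : 0 < e / ln l by rewrite divr_gt0.
have /cvgrPdistC_le /(_ _ el0) He := lim.
have Ff' := eventually_forall_ge Ff.
have F0' := eventually_forall_ge F0.
have He' := eventually_forall_ge He.
near=> t.
have t0 : 0 < t by [].
have F0t : forall x, t <= x -> 0 < F x by near: t.
have Fft : forall x, t <= x -> is_derive x 1 F (f x) by near: t.
have Het : forall x, t <= x -> `|x * f x / F x - s| <= e / ln l by near: t.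
have tl : t < l * t by rewrite ltr_pMl.
(* Comparing [ln F] with [ln] makes the ratio of derivatives equal to [z * f z / F z], which is
   close to [s], while the increment of [ln] is exactly [ln l]. *)
have [|||z /andP[tz zl] H] := @cauchy_mean_value _ (@ln R \o F) (@ln R)
    (fun x => f x / F x) (fun x => x^-1) t _ _ _ t (l * t) (lexx t) tl.
- move=> x tx; rewrite mulrC; apply: is_derive1_comp; last exact: Fft.
  by apply: is_derive1_ln; exact: F0t.
- by move=> x tx; apply: is_derive1_ln; exact: lt_le_trans tx.
- by move=> x tx; rewrite gt_eqF// invr_gt0 (lt_le_trans t0).
have Flt : 0 < F (l * t) by apply: F0t; exact: ltW.
rewrite ln_div ?posrE// ?F0t//; move: H => /= ->.
rewrite lnM ?posrE// addrK invrK -mulrBl normrM (gtr0_norm lnl0) -ler_pdivlMr//.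
by rewrite mulrC mulrA Het.
Unshelve. all: end_near. Qed.

End regular_variation.

(** * De Haan limits at index -1, remainders of convergent primitives, and continuity tools *)

Section de_haan_class.
Context {R : realType}.
Implicit Types f g h F : R -> R.

Lemma cvg_powR_zero f (c : R) : 0 < c -> (\forall t \near +oo, 0 <= f t) ->
  f t @[t --> +oo] --> 0 -> f t `^ c @[t --> +oo] --> 0.
Proof.
move=> c0 f0 fl; apply/cvgr0Pnorm_le => e e0.
have ec0 : 0 < e `^ c^-1 by exact: powR_gt0.
move/cvgr0Pnorm_le : fl => /(_ _ ec0) fl; near=> t.
have ft : 0 <= f t by near: t.
have : `|f t| <= e `^ c^-1 by near: t.
rewrite !ger0_norm ?powR_ge0// => fe.
have -> : e = (e `^ c^-1) `^ c by rewrite -powRrM mulVf ?gt_eqF// powRr1// ltW.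
by rewrite ge0_ler_powR ?nnegrE ?powR_ge0// ltW.
Unshelve. all: end_near. Qed.

Lemma cvg_zero_bounded f g (B : R) : (\forall t \near +oo, `|g t| <= B * `|f t|) ->
  f t @[t --> +oo] --> 0 -> g t @[t --> +oo] --> 0.
Proof.
move=> gB /cvgr0Pnorm_le fl; apply/cvgr0Pnorm_le => e e0.
have B0 : 0 < `|B| + 1 by rewrite ltr_pwDr.
have := fl (e / (`|B| + 1)); rewrite divr_gt0// => /(_ isT).
apply: filterS2 gB => t gB fe; rewrite (le_trans gB)//.
rewrite (le_trans (ler_wpM2r (normr_ge0 _) (ler_norm B)))//.
rewrite (le_trans (ler_wpM2l (normr_ge0 _) fe))//.
by rewrite mulrCA ger_pMr// ler_pdivrMr// mul1r lerDl.
Qed.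

Lemma de_haan_ln f F : (\forall t \near +oo, is_derive (t : R) 1 F (f t)) ->
  (\forall t \near +oo, {for t, continuous f}) ->
  regularly_varying (-1) f ->
  forall l, 0 < l -> (F (l * t) - F t) / (t * f t) @[t --> +oo] --> ln l.
Proof.
move=> Ff cf fs.
have gt1 l : 1 < l -> (F (l * t) - F t) / (t * f t) @[t --> +oo] --> ln l.
  move=> l1; have l0 : 0 < l by exact: lt_trans l1.
  apply: (@de_haan _ f (@ln R) F 0) => //; first by rewrite sub0r.
    by move=> t t0; rewrite sub0r powR_inv1 ?ltW//; exact: is_derive1_ln.
  by move=> t t0; rewrite lnM ?posrE// powRr0; ring.
have [f0 fl] := fs.
move=> l l0; have [l1|l1|<-] := ltgtP 1 l.
- exact: gt1.
- have li : 1 < l^-1 by rewrite invf_gt1.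
  have H := cvg_comp_pinfty (cvg_scale l0) (gt1 _ li).
  (* [H] is normalized by [l * t * f (l * t)]; the factors [f (l * t) / f t] and [- l] restore the
     normalization by [t * f t] and reverse the increment. *)
  have H2 := cvgyM (cvgyM H (fl _ l0)) (cvgy_cst (- l)).
  have E : ln l^-1 * l `^ (-1) * - l = ln l.
    by rewrite lnV ?posrE// powR_inv1 ?ltW//; field; rewrite gt_eqF.
  rewrite E in H2; apply: cvg_near_eq H2.
  have f0l := near_scale l0 f0.
  near=> t.
  have ft : 0 < f t by near: t.
  have ftl : 0 < f (l * t) by near: t.
  have t0 : 0 < t by [].
  by rewrite mulKf ?gt_eqF//; field; rewrite !gt_eqF.
- rewrite ln1; apply: cvg_near_eq (cvgy_cst 0); near=> t.
  by rewrite mul1r subrr mul0r.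
Unshelve. all: end_near. Qed.

(** Put [G = M - F]. L'Hopital in the form 0/0 gives [G (l * t) / G t -> l * l^-1 = 1]. Then
    [1 - G (2 * t) / G t] tends to 0; it equals [(F (2 * t) - F t) / G t], whose numerator is
    asymptotic to [ln 2 * t * f t]. *)
Lemma slowly_varying_remainder f F (M : R) :
  (\forall t \near +oo, is_derive (t : R) 1 F (f t)) ->
  (\forall t \near +oo, {for t, continuous f}) ->
  regularly_varying (-1) f -> F t @[t --> +oo] --> M ->
  regularly_varying 0 (fun t => M - F t) /\
  t * f t / (M - F t) @[t --> +oo] --> 0.
Proof.
move=> Ff cf fs FM; have [f0 fl] := fs.
have dG : \forall t \near +oo, is_derive (t : R) 1 (fun t => M - F t) (- f t).
  near=> t; have Ft : is_derive t 1 F (f t) by near: t.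
  have H := @is_deriveB _ _ _ (cst M) F t 1 0 (f t).
  by rewrite -[- f t]add0r; apply: H.
have G0 : (M - F t) @[t --> +oo] --> 0.
  by rewrite -(subrr M); apply: cvgyB => //; exact: cvgy_cst.
(* Strictness comes from the intermediate point: [F t < F (t + 1)], and the latter is at most
   [M]. *)
have Gpos : \forall t \near +oo, 0 < M - F t.
  have [c Hc] : exists c : R, forall x : R, c <= x ->
      is_derive x 1 F (f x) /\ 0 < f x.
    by apply: eventually_exists; near=> t; split; near: t.
  have incr : forall x y, c <= x -> x < y -> F x < F y.
    by apply: (@pos_derive_increasing _ F f) => x /Hc[].
  near=> t.
  have ct : c <= t by near: t; apply: nbhs_pinfty_ge; rewrite num_real.
  rewrite subr_gt0 (@lt_le_trans _ _ (F (t + 1)))// ?incr// ?ltrDl//.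
  apply: (cvgr_to_ge FM); near=> s.
  have ts : t + 1 < s by near: s; apply: nbhs_pinfty_gt; rewrite num_real.
  by rewrite ltW// incr// (le_trans ct)// lerDl.
have Glim l : 0 < l -> (M - F (l * t)) / (M - F t) @[t --> +oo] --> (1 : R).
  move=> l0.
  apply: (@lhopital_pinfty_zero _ _ _ (fun t => l * - f (l * t)) (fun t => - f t)).
  - have := near_scale l0 dG; apply: filterS => t.
    exact: (@is_derive_scale _ (fun t => M - F t)).
  - exact: dG.
  - by apply: filterS f0 => t; rewrite oppr_lt0.
  - exact: cvg_comp_pinfty (cvg_scale l0) G0.
  - exact: G0.
  - have H := cvgyM (cvgy_cst l) (fl l l0).
    have E : l * l `^ (-1) = 1 by rewrite powR_inv1 ?ltW// divff// gt_eqF.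
    rewrite E in H; apply: cvg_near_eq H; near=> t.
    have ft : 0 < f t by near: t.
    by field; rewrite gt_eqF.
split; first by split => // l l0; rewrite powRr0; exact: Glim.
have ln2 : ln 2 != 0 :> R by rewrite gt_eqF// ln_gt0// ltr1n.
have D := de_haan_ln Ff cf fs (ltr0Sn R 1).
have H := cvgyM (cvgyB (cvgy_cst 1) (Glim 2 (ltr0Sn R 1))) (cvgyV ln2 D).
rewrite subrr mul0r in H; apply: cvg_near_eq H.
have D' : \forall t \near +oo, (F (2 * t) - F t) / (t * f t) != 0.
  exact: cvgr_neq0 D ln2.
near=> t.
have Gt : 0 < M - F t by near: t.
have ft : 0 < f t by near: t.
have t0 : 0 < t by [].
have : (F (2 * t) - F t) / (t * f t) != 0 by near: t.
rewrite mulf_eq0 negb_or => /andP[Dt _].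
by field; rewrite Dt !gt_eqF.
Unshelve. all: end_near. Qed.

Lemma within_continuous_in f (A : set R) :
  (forall x, A x -> {for x, continuous f}) -> {within A, continuous f}.
Proof. by move=> cf; apply: continuous_in_subspaceT => x /set_mem; exact: cf. Qed.

Lemma continuous_for_comp f g (x : R) : {for x, continuous g} ->
  {for g x, continuous f} -> {for x, continuous (fun t => f (g t))}.
Proof. by move=> cg cf; exact: continuous_comp. Qed.

Lemma continuous_for_powR f (c x : R) : {for x, continuous f} -> 0 < f x ->
  {for x, continuous (fun t => f t `^ c)}.
Proof.
move=> cf f0; apply: (continuous_for_comp (f := fun z => z `^ c)) => //.
exact: continuous_powR.
Qed.

(** Supplies a primitive for Karamata's theorem when the function is known only through its
    continuity for large arguments. *)
Lemma eventual_primitive f : (\forall t \near +oo, {for t, continuous f}) ->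
  exists F, \forall t \near +oo, is_derive (t : R) 1 F (f t).
Proof.
move=> /eventually_exists[X cf].
exists (fun x => \int[lebesgue_measure]_(s in `[X, x]) f s); near=> t.
have Xt : X < t by near: t; apply: nbhs_pinfty_gt; rewrite num_real.
have t1 : t < t + 1 by rewrite ltrDl.
have fi : lebesgue_measure.-integrable `[X, t + 1] (EFin \o f).
  apply: continuous_compact_integrable; first exact: segment_compact.
  by apply: within_continuous_in => x /=; rewrite in_itv/= => /andP[/cf].
have [d1 d2] := continuous_FTC1_closed t1 fi Xt (cf t (ltW Xt)).
by rewrite -d2 derive1E; apply: DeriveDef.
Unshelve. all: end_near. Qed.

End de_haan_class.

(** * Integrals *)

Section integration.
Context {R : realType}.
Implicit Types f g h F : R -> R.
Notation mu := (@lebesgue_measure R).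

(** Made for [r] composed with [tau]: [tau] may take the value [a], where [r] is continuous only
    from the right. *)
Lemma within_continuous_comp_within (A B : set R) f g :
  {within A, continuous f} -> {within B, continuous g} -> f @` A `<=` B ->
  {within A, continuous (g \o f)}.
Proof.
move=> /subspace_continuousP cf /subspace_continuousP cg AB.
apply/subspace_continuousP => x Ax.
have Bfx : B (f x) by apply: AB; exists x.
apply: (@cvg_comp _ _ _ f g _ (within B (nbhs (f x)))); last exact: cg.
move=> W BW; have := cf x Ax _ BW; rewrite !nbhs_simpl/=.
rewrite /within/= /nbhs/=; apply: filterS => y fy Ay; apply: fy => //.
by apply: AB; exists y.
Qed.

Lemma within_continuousM (A : set R) f g : {within A, continuous f} ->
  {within A, continuous g} -> {within A, continuous (fun x => f x * g x)}.
Proof. by move=> cf cg x; apply: continuousM; [exact: cf|exact: cg]. Qed.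

Lemma within_continuous_powR (A : set R) f (c : R) : {within A, continuous f} ->
  (forall x, A x -> 0 < f x) -> {within A, continuous (fun x => f x `^ c)}.
Proof.
move=> cf f0; apply: (@within_continuous_comp _ _ _ A f (fun z => z `^ c)) => //.
by move=> _ /set_mem[x Ax <-]; apply: continuous_powR; exact: f0.
Qed.

Lemma within_continuousV (A : set R) f : {within A, continuous f} ->
  (forall x, A x -> f x != 0) -> {within A, continuous (fun x => (f x)^-1)}.
Proof.
move=> /subspace_continuousP cf f0; apply/subspace_continuousP => x Ax.
by apply: cvgV; [exact: f0|exact: cf].
Qed.

Lemma within_continuous_for (a : R) f : {within `[a, +oo[, continuous f} ->
  forall x, a < x -> {for x, continuous f}.
Proof.
by move=> /continuous_within_itvcyP[cf _] x ax; apply: cf; rewrite in_itv/= ax.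
Qed.

Lemma near_within_continuous (a : R) f : {within `[a, +oo[, continuous f} ->
  \forall t \near +oo, {for t, continuous f}.
Proof.
move=> /within_continuous_for cf; near=> t; apply: cf.
by near: t; apply: nbhs_pinfty_gt; rewrite num_real.
Unshelve. all: end_near. Qed.

Lemma within_continuous_integrable f (u v : R) :
  {within `[u, v], continuous f} -> mu.-integrable `[u, v] (EFin \o f).
Proof.
by move=> cf; apply: continuous_compact_integrable => //; exact: segment_compact.
Qed.

Lemma continuous_integrable f (u v : R) :
  (forall x, u <= x -> {for x, continuous f}) ->
  mu.-integrable `[u, v] (EFin \o f).
Proof.
move=> cf; apply: within_continuous_integrable; apply: within_continuous_in => x /=.
by rewrite in_itv/= => /andP[ux _]; exact: cf.
Qed.

Lemma continuous_measurable_ray f (u : R) :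
  (forall x, u <= x -> {for x, continuous f}) -> measurable_fun `[u, +oo[ f.
Proof.
move=> cf; apply: subspace_continuous_measurable_fun => //.
apply: within_continuous_in => x /=; rewrite in_itv/= andbT; exact: cf.
Qed.

Lemma fundamental_theorem f F (u v : R) : u <= v ->
  (forall x, u <= x -> is_derive x 1 F (f x)) ->
  (forall x, u <= x -> {for x, continuous f}) ->
  \int[mu]_(x in `[u, v]) f x = F v - F u.
Proof.
rewrite le_eqVlt => /predU1P[<- _ _|uv dF cf].
  by rewrite set_itv1 Rintegral_set1 subrr.
have cF x : u <= x -> {for x, continuous F} by move=> /dF; exact: is_derive_continuous.
rewrite /Rintegral (@continuous_FTC2 _ f F u v uv)//.
- apply: within_continuous_in => x /=; rewrite in_itv/= => /andP[ux _]; exact: cf.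
- split.
  + move=> x; rewrite in_itv/= => /andP[ux _].
    exact: (@ex_derive _ _ _ _ _ _ _ (dF x (ltW ux))).
  + by apply: cvg_at_right_filter; exact: cF.
  + by apply: cvg_at_left_filter; apply: cF; exact: ltW.
- move=> x; rewrite in_itv/= => /andP[ux _].
  by rewrite derive1E (@derive_val _ _ _ _ _ _ _ (dF x (ltW ux))).
Qed.

Lemma Rintegral_cst_itv (c u v : R) : u <= v ->
  \int[mu]_(x in `[u, v]) c = c * (v - u).
Proof.
move=> uv.
rewrite (fundamental_theorem uv (fun x _ => is_derive_mulrl c x)) ?mulrBr//.
by move=> x _; exact: cst_continuous.
Qed.

Lemma fundamental_theorem_pinfty f F (u l : R) :
  (forall x, u <= x -> is_derive x 1 F (f x)) ->
  (forall x, u <= x -> {for x, continuous f}) ->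
  (forall x, u <= x -> 0 <= f x) -> F x @[x --> +oo] --> l ->
  (\int[mu]_(x in `[u, +oo[) (f x)%:E = (l - F u)%:E)%E.
Proof.
move=> dF cf f0 Fl.
have cF x : u <= x -> {for x, continuous F} by move=> /dF; exact: is_derive_continuous.
rewrite (@ge0_continuous_FTC2y _ f F u l)//.
- apply: within_continuous_in => x /=; rewrite in_itv/= andbT; exact: cf.
- move=> x ux; exact: (@ex_derive _ _ _ _ _ _ _ (dF x (ltW ux))).
- by apply: cvg_at_right_filter; exact: cF.
- move=> x; rewrite in_itv/= andbT => ux.
  by rewrite derive1E (@derive_val _ _ _ _ _ _ _ (dF x (ltW ux))).
Qed.

Lemma fundamental_integrable_pinfty f F (u l : R) :
  (forall x, u <= x -> is_derive x 1 F (f x)) ->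
  (forall x, u <= x -> {for x, continuous f}) ->
  (forall x, u <= x -> 0 <= f x) -> F x @[x --> +oo] --> l ->
  mu.-integrable `[u, +oo[ (EFin \o f).
Proof.
move=> dF cf f0 Fl; apply/integrableP; split.
  by apply/measurable_EFinP; exact: continuous_measurable_ray.
have -> : (\int[mu]_(x in `[u, +oo[) `|(EFin \o f) x| =
    \int[mu]_(x in `[u, +oo[) (f x)%:E)%E.
  apply: eq_integral => x; rewrite inE/= in_itv/= andbT => ux.
  by rewrite ger0_norm// f0.
by rewrite (fundamental_theorem_pinfty dF cf f0 Fl) ltry.
Qed.

Lemma regularly_varying_RV (theta t0 : R) f :
  (forall t, t0 <= t -> {for t, continuous f}) -> (forall t, t0 <= t -> 0 < f t) ->
  regularly_varying theta f -> RV theta f.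
Proof.
move=> cf f0 [_ fl]; split => //; exists t0; split => //.
exact: continuous_measurable_ray.
Qed.

Lemma RV_regularly_varying (theta : R) f : RV theta f -> regularly_varying theta f.
Proof.
move=> [[t0 [_ f0]] fl]; split => //; near=> t; apply: f0.
by near: t; apply: nbhs_pinfty_ge; rewrite num_real.
Unshelve. all: end_near. Qed.

(** The function [psi] is the deviation of [t * f t / F t] from [theta]. A primitive of [psi s / s]
    is [ln (F s) - theta * ln s], so exponentiating its increment from [u] returns [F t], with
    constant [F u / u ^ theta]. *)
Lemma normalized_NRV (theta : R) f F :
  (\forall t \near +oo, is_derive (t : R) 1 F (f t)) ->
  (\forall t \near +oo, {for t, continuous f}) ->
  (\forall t \near +oo, 0 < F t) ->
  t * f t / F t @[t --> +oo] --> theta -> NRV theta F.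
Proof.
move=> dF cf F0 lim.
have [u Hu] : exists u : R, forall t : R, u <= t -> [/\ 0 < t,
    is_derive t 1 F (f t), {for t, continuous f} & 0 < F t].
  apply: eventually_exists; near=> t.
  by split; near: t => //; apply: nbhs_pinfty_gt; rewrite num_real.
have [u0 _ _ Fu] := Hu _ (lexx u).
have upos t : u <= t -> 0 < t by move=> /Hu[].
have dFu t : u <= t -> is_derive t 1 F (f t) by move=> /Hu[].
have cfu t : u <= t -> {for t, continuous f} by move=> /Hu[].
have Fpos t : u <= t -> 0 < F t by move=> /Hu[].
pose psi t := t * f t / F t - theta.
have cFu t : u <= t -> {for t, continuous F}.
  by move=> /dFu; exact: is_derive_continuous.
have cpsi t : u <= t -> {for t, continuous psi}.
  move=> ut; apply: continuousB; last exact: cst_continuous.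
  apply: continuousM.
    by apply: continuousM; [exact: cvg_id|exact: cfu].
  by apply: continuousV; [rewrite gt_eqF// Fpos|exact: cFu].
have cpsit t : u <= t -> {for t, continuous (fun s => psi s / s)}.
  move=> ut; apply: continuousM; first exact: cpsi.
  by apply: continuousV; [rewrite gt_eqF// upos|exact: cvg_id].
exists u, (F u / u `^ theta), psi; split => //.
- by rewrite divr_gt0// powR_gt0.
- exact: continuous_measurable_ray.
- by rewrite -(subrr theta); apply: cvgyB => //; exact: cvgy_cst.
move=> t ut; split; first exact: continuous_integrable.
have t0 := upos _ ut; have Ft := Fpos _ ut.
have dG x : u <= x -> is_derive x 1 (fun s => ln (F s) - theta * ln s) (psi x / x).
  move=> ux; have x0 := upos _ ux; have Fx := Fpos _ ux.
  have d1 : is_derive x 1 (@ln R \o F) ((F x)^-1 * f x).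
    by apply: is_derive1_comp; [exact: is_derive1_ln|exact: dFu].
  have d2 : is_derive x 1 (theta *: @ln R) (theta * x^-1).
    by apply: is_deriveZ; exact: is_derive1_ln.
  have -> : psi x / x = (F x)^-1 * f x - theta * x^-1.
    by rewrite /psi; field; rewrite !gt_eqF.
  by have := is_deriveB d1 d2.
rewrite (fundamental_theorem ut dG cpsit).
rewrite [X in expR X](_ : _ = ln (F t / F u) - ln (t `^ theta / u `^ theta)).
  rewrite expRB !lnK ?posrE ?divr_gt0 ?powR_gt0//.
  have tt : 0 < t `^ theta by exact: powR_gt0.
  have uu : 0 < u `^ theta by exact: powR_gt0.
  by field; rewrite !gt_eqF.
by rewrite !ln_div ?posrE ?powR_gt0// !ln_powR; ring.
Unshelve. all: end_near. Qed.

(** Here [psi] is merely measurable, so the integral itself is estimated: [f (l * t) / f t] is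
    [l ^ theta] times the exponential of the integral of [psi s / s] over [[t, l * t]]. *)
Lemma NRV_regularly_varying (theta : R) f : NRV theta f -> regularly_varying theta f.
Proof.
move=> [u [C [psi [u0 C0 mpsi psi0 fE]]]].
have f0 t : u <= t -> 0 < f t.
  move=> ut; have [_ ->] := fE _ ut.
  by rewrite !mulr_gt0 ?expR_gt0// powR_gt0// (lt_le_trans u0).
apply: regularly_varying_gt1.
  by near=> t; apply: f0; near: t; apply: nbhs_pinfty_ge; rewrite num_real.
move=> l l1; have l0 : 0 < l by exact: lt_trans l1.
pose I t := \int[mu]_(s in `[u, t]) (psi s / s).
have II : I (l * t) - I t @[t --> +oo] --> 0.
  apply/cvgr0Pnorm_le => e e0.
  (* On [[t, l * t]], of length [(l - 1) * t], the integrand is at most [e / (l - 1) / t] in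
     absolute value, so the integral is at most [e]. *)
  have el0 : 0 < e / (l - 1) by rewrite divr_gt0// subr_gt0.
  have /cvgr0Pnorm_le /(_ _ el0) psie := psi0.
  have psie' := eventually_forall_ge psie.
  near=> t.
  have t0 : 0 < t by [].
  have ut : u <= t by [].
  have psit : forall s, t <= s -> `|psi s| <= e / (l - 1) by near: t.
  have tl : t < l * t by rewrite ltr_pMl.
  have [il _] := fE (l * t) (le_trans ut (ltW tl)).
  rewrite /I Rintegral_itvB//; last by rewrite bnd_simp ltW.
  have il' : mu.-integrable `[t, l * t] (EFin \o (fun s => psi s / s)).
    apply: integrableS il => //.
    by apply: subset_itvr; rewrite bnd_simp.
  rewrite Rintegral_itv_obnd_cbnd; last first.
    by apply: integrableS il' => //; exact: subset_itv_oc_cc.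
  rewrite (le_trans (le_normr_Rintegral _ il'))//.
  have -> : e = \int[mu]_(x in `[t, l * t]) (e / (l - 1) / t).
    rewrite Rintegral_cst_itv ?ltW//.
    by field; rewrite subr_eq0 !gt_eqF.
  apply: le_Rintegral => //.
  - exact: integrable_norm il'.
  - by apply: continuous_integrable => x _; exact: cst_continuous.
  - move=> x; rewrite /= in_itv/= => /andP[tx _].
    have x0 : 0 < x by exact: lt_le_trans tx.
    rewrite normrM normfV (gtr0_norm x0) ler_pM ?invr_ge0 ?(ltW x0) ?psit//.
    by rewrite lef_pV2 ?posrE.
have EI : expR (I (l * t) - I t) @[t --> +oo] --> (1 : R).
  by rewrite -expR0; apply: (cvg_comp _ _ II); exact: continuous_expR.
have := cvgyM (cvgy_cst (l `^ theta)) EI; rewrite mulr1; apply: cvg_near_eq.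
near=> t.
have t0 : 0 < t by [].
have ut : u <= t by [].
have tl : t < l * t by rewrite ltr_pMl.
have [_ ->] := fE _ ut.
have [_ ->] := fE _ (le_trans ut (ltW tl)).
rewrite -/(I t) -/(I (l * t)) expRB powRM ?(ltW l0) ?(ltW t0)//.
have tt : 0 < t `^ theta by exact: powR_gt0.
by field; rewrite !gt_eqF// expR_gt0.
Unshelve. all: end_near. Qed.

End integration.

(** * Integral representations with an error term, and comparison of integrals *)

Section representation.
Context {R : realType}.
Implicit Types f g h F H : R -> R.
Notation mu := (@lebesgue_measure R).

Lemma itv_setI_ray (T u v : R) : T <= u ->
  [set` `[T, v]] `&` [set` `[u, +oo[] = [set` `[u, v]].
Proof.
move=> Tu; apply/seteqP; split => x /=; rewrite !in_itv/= ?andbT.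
  by move=> [/andP[_ ->] ->].
by move=> /andP[ux ->]; rewrite (le_trans Tu).
Qed.

Lemma ray_setI_ray (s u : R) :
  [set` `[s, +oo[] `&` [set` `[u, +oo[] = [set` `[Num.max s u, +oo[].
Proof.
by apply/seteqP; split => x /=; rewrite !in_itv/= !andbT ge_max => /andP.
Qed.

Lemma integrable_restrict_ray g (T u v : R) : T <= u ->
  (forall x, u <= x -> {for x, continuous g}) ->
  mu.-integrable `[T, v] (EFin \o (g \_ `[u, +oo[)).
Proof.
move=> Tu cg; rewrite -restrict_EFin; apply/integrable_restrict => //.
by rewrite itv_setI_ray//; exact: continuous_integrable.
Qed.

(** Where [F' = f] is available, [eps] must be [f / (k * H) - 1], which tends to 0; the freedom left
    on the initial interval adjusts the constant of integration to [D]. *)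
Lemma exponent_representation (T k D : R) H f F :
  (forall t, T <= t -> k * H t != 0) ->
  (\forall t \near +oo, is_derive (t : R) 1 F (f t)) ->
  (\forall t \near +oo, {for t, continuous f}) ->
  f t / (k * H t) @[t --> +oo] --> (1 : R) ->
  exists eps : R -> R,
    [/\ eps t @[t --> +oo] --> 0,
        forall t, T <= t ->
          mu.-integrable `[T, t] (fun s => ((1 + eps s) * k * H s)%:E) &
        \forall t \near +oo,
          \int[mu]_(s in `[T, t]) ((1 + eps s) * k * H s) = F t - D].
Proof.
move=> kH dF cf lim.
have [u Hu] : exists u : R, forall t : R, u <= t -> [/\ T < t,
    is_derive t 1 F (f t) & {for t, continuous f}].
  apply: eventually_exists; near=> t.
  by split; near: t => //; apply: nbhs_pinfty_gt; rewrite num_real.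
have [Tu _ _] := Hu _ (lexx u).
(* On [T, u[ the function eps makes the integrand equal to the constant c, which
   produces the prescribed constant D. *)
pose c := (F u - D) / (u - T).
(* The integral of [h] over [[T, t]] is [c * (t - T)] plus the increment of [F s - c * s] over
   [[u, t]]. Its value is [F t - F u + c * (u - T)], that is [F t - D]. *)
pose g s := f s - c.
pose h s := c + (g \_ `[u, +oo[) s.
have cg x : u <= x -> {for x, continuous g}.
  by move=> /Hu[_ _ cfx]; apply: continuousB => //; exact: cst_continuous.
have hu s : u <= s -> h s = f s.
  by move=> us; rewrite /h patchE ifT ?inE/= ?in_itv/= ?us// /g addrC subrK.
pose eps s := h s / (k * H s) - 1.
have hE s : T <= s -> (1 + eps s) * k * H s = h s.
  by move=> Ts; rewrite /eps addrC subrK -mulrA divfK// kH.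
have ih t : mu.-integrable `[T, t] (EFin \o h).
  have -> : EFin \o h = (EFin \o cst c) \+ (EFin \o (g \_ `[u, +oo[)).
    by apply/funext => s; rewrite /= EFinD.
  apply: integrableD => //.
    by apply: continuous_integrable => x _; exact: cst_continuous.
  by apply: integrable_restrict_ray => //; exact: ltW.
exists eps; split.
- rewrite -(subrr 1); apply: cvgyB; last exact: cvgy_cst.
  apply: cvg_near_eq lim; near=> t.
  by rewrite hu.
- move=> t Tt; apply: eq_integrable (ih t) => //.
  by move=> s; rewrite inE/= in_itv/= => /andP[Ts _]; rewrite hE.
near=> t.
have ut : u <= t by [].
have -> : \int[mu]_(s in `[T, t]) ((1 + eps s) * k * H s) =
    \int[mu]_(s in `[T, t]) h s.
  by apply: eq_Rintegral => s; rewrite inE/= in_itv/= => /andP[Ts _]; rewrite hE.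
rewrite /h RintegralD//; last 2 first.
- by apply: continuous_integrable => x _; exact: cst_continuous.
- by apply: integrable_restrict_ray => //; exact: ltW.
rewrite Rintegral_cst_itv ?(le_trans (ltW Tu))//.
rewrite -Rintegral_mkcondr itv_setI_ray ?(ltW Tu)//.
have dG x : u <= x -> is_derive x 1 (fun s => F s - c * s) (g x).
  by move=> /Hu[_ dFx _]; exact: (is_deriveB dFx (is_derive_mulrl c x)).
rewrite (fundamental_theorem ut dG cg).
by rewrite /c; field; rewrite subr_eq0 gt_eqF.
Unshelve. all: end_near. Qed.

(** Integrating to infinity fixes the constant through the limit [l], so nothing has to be absorbed
    on the initial interval. The maximum with [u] records that the integrand is zero to the left of
    [u]. *)
Lemma tail_representation (T k l u : R) H f F : T <= u ->
  (forall t, T <= t -> k * H t != 0) ->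
  (forall t, u <= t -> is_derive t 1 F (f t)) ->
  (forall t, u <= t -> {for t, continuous f}) ->
  (forall t, u <= t -> 0 <= f t) ->
  F t @[t --> +oo] --> l ->
  f t / (k * H t) @[t --> +oo] --> (1 : R) ->
  exists eps : R -> R,
    [/\ eps t @[t --> +oo] --> 0,
        mu.-integrable `[T, +oo[ (fun s => ((1 + eps s) * k * H s)%:E) &
        forall t, T <= t ->
          \int[mu]_(s in `[t, +oo[) ((1 + eps s) * k * H s) =
            l - F (Num.max t u)].
Proof.
move=> Tu kH dF cf f0 Fl lim.
(* eps = -1 on [T, u[, so that the integrand vanishes there. *)
pose h := f \_ `[u, +oo[.
have hu s : u <= s -> h s = f s.
  by move=> us; rewrite /h patchE ifT ?inE/= ?in_itv/= ?us.
pose eps s := h s / (k * H s) - 1.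
have hE s : T <= s -> (1 + eps s) * k * H s = h s.
  by move=> Ts; rewrite /eps addrC subrK -mulrA divfK// kH.
exists eps; split.
- rewrite -(subrr 1); apply: cvgyB; last exact: cvgy_cst.
  apply: cvg_near_eq lim; near=> t.
  by rewrite hu.
- have ih : mu.-integrable `[T, +oo[ (EFin \o h).
    rewrite -restrict_EFin; apply/integrable_restrict => //.
    rewrite ray_setI_ray max_r//.
    exact: fundamental_integrable_pinfty dF cf f0 Fl.
  apply: eq_integrable ih => //.
  by move=> s; rewrite inE/= in_itv/= andbT => Ts; rewrite hE.
move=> t Tt.
have -> : \int[mu]_(s in `[t, +oo[) ((1 + eps s) * k * H s) =
    \int[mu]_(s in `[t, +oo[) h s.
  apply: eq_Rintegral => s; rewrite inE/= in_itv/= andbT => ts.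
  by rewrite hE// (le_trans Tt).
rewrite -Rintegral_mkcondr ray_setI_ray /Rintegral.
have um : u <= Num.max t u by rewrite le_max lexx orbT.
have mu_ge x : Num.max t u <= x -> u <= x by exact: le_trans.
have := fundamental_theorem_pinfty (fun x mx => dF x (mu_ge x mx))
  (fun x mx => cf x (mu_ge x mx)) (fun x mx => f0 x (mu_ge x mx)) Fl.
by move=> ->.
Unshelve. all: end_near. Qed.

(** Together with [integral_ray_finite] this decides whether [q] stays bounded: the derivative of
    [ln q] is comparable to [H] in both directions. *)
Lemma primitive_bounded (T c : R) H f F :
  measurable_fun `[T, +oo[ H ->
  (forall t, T <= t -> 0 <= H t) ->
  (\int[mu]_(s in `[T, +oo[) (H s)%:E < +oo)%E ->
  (\forall t \near +oo, is_derive (t : R) 1 F (f t)) ->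
  (\forall t \near +oo, {for t, continuous f}) ->
  (\forall t \near +oo, f t <= c * H t) ->
  exists B, \forall t \near +oo, F t <= B.
Proof.
move=> mH H0 iH dF cf fH.
have [u Hu] : exists u : R, forall t : R, u <= t -> [/\ T <= t,
    is_derive t 1 F (f t), {for t, continuous f} & f t <= c * H t].
  apply: eventually_exists; near=> t.
  by split; near: t => //; apply: nbhs_pinfty_ge; rewrite num_real.
have [Tu _ _ _] := Hu _ (lexx u).
have mHT : measurable_fun `[T, +oo[ (EFin \o H) by apply/measurable_EFinP.
have HI : mu.-integrable `[T, +oo[ (EFin \o H).
  apply/integrableP; split => //.
  rewrite (_ : (\int[mu]_(s in `[T, +oo[) _ = \int[mu]_(s in `[T, +oo[) (H s)%:E)%E)//.
  apply: eq_integral => s; rewrite inE/= in_itv/= andbT => Ts.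
  by rewrite ger0_norm// H0.
have sub t : [set` `[u, t]] `<=` [set` `[T, +oo[].
  by move=> x /=; rewrite !in_itv/= andbT => /andP[ux _]; exact: le_trans ux.
have HIt t : mu.-integrable `[u, t] (EFin \o H).
  by apply: integrableS HI.
have Hle t : \int[mu]_(s in `[u, t]) H s <= \int[mu]_(s in `[T, +oo[) H s.
  rewrite /Rintegral fine_le//.
  - exact: integrable_fin_num (HIt t).
  - exact: integrable_fin_num HI.
  - apply: ge0_subset_integral => //.
    by move=> s /=; rewrite in_itv/= andbT => Ts; rewrite lee_fin H0.
(* The absolute value gives a nonnegative multiple of [H], so that the integral over [[u, t]] may be
   enlarged to the whole ray. *)
exists (F u + `|c| * \int[mu]_(s in `[T, +oo[) H s); near=> t.
have ut : u <= t by [].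
rewrite -lerBlDl.
have dFu x : u <= x -> is_derive x 1 F (f x) by move=> /Hu[].
have cfu x : u <= x -> {for x, continuous f} by move=> /Hu[].
rewrite -(fundamental_theorem ut dFu cfu).
have cHI : mu.-integrable `[u, t] (EFin \o (fun s => `|c| * H s)).
  have -> : EFin \o (fun s => `|c| * H s) = (fun s => `|c|%:E * (EFin \o H) s)%E.
    by apply/funext => s; rewrite /= EFinM.
  exact: integrableZl.
apply: (@le_trans _ _ (\int[mu]_(s in `[u, t]) (`|c| * H s))).
  apply: le_Rintegral => //; first exact: continuous_integrable.
  move=> s /=; rewrite in_itv/= => /andP[us _].
  have [Ts _ _ fs] := Hu _ us.
  by rewrite (le_trans fs)// ler_wpM2r ?H0// ler_norm.
by rewrite RintegralZl// ler_wpM2l.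
Unshelve. all: end_near. Qed.

(** Convergence of [F] makes [f] integrable near infinity, hence also [H], which it dominates there;
    on the remaining bounded interval continuity of [H] suffices. *)
Lemma integral_ray_finite (T c l : R) H f F :
  {within `[T, +oo[, continuous H} ->
  (forall t, T <= t -> 0 <= H t) ->
  (\forall t \near +oo, is_derive (t : R) 1 F (f t)) ->
  (\forall t \near +oo, {for t, continuous f}) ->
  (\forall t \near +oo, 0 <= f t) ->
  (\forall t \near +oo, H t <= c * f t) -> F t @[t --> +oo] --> l ->
  (\int[mu]_(s in `[T, +oo[) (H s)%:E < +oo)%E.
Proof.
move=> cH H0 dF cf f0 Hf Fl.
have [u Hu] : exists u : R, forall t : R, u <= t -> [/\ T <= t,
    is_derive t 1 F (f t), {for t, continuous f}, 0 <= f t & H t <= c * f t].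
  apply: eventually_exists; near=> t.
  by split; near: t => //; apply: nbhs_pinfty_ge; rewrite num_real.
have [Tu _ _ _ _] := Hu _ (lexx u).
have dFu x : u <= x -> is_derive x 1 F (f x) by move=> /Hu[].
have cfu x : u <= x -> {for x, continuous f} by move=> /Hu[].
have f0u x : u <= x -> 0 <= f x by move=> /Hu[].
have mH : measurable_fun `[T, +oo[ (EFin \o H).
  by apply/measurable_EFinP; apply: subspace_continuous_measurable_fun.
have E : [set` `[T, +oo[] = [set` `[T, u[] `|` [set` `[u, +oo[].
  by rewrite -itv_bndbnd_setU// bnd_simp.
have subR : [set` `[u, +oo[] `<=` [set` `[T, +oo[].
  by move=> x /=; rewrite !in_itv/= !andbT; exact: le_trans.
rewrite E ge0_integral_setU//; last 3 first.
- by rewrite -E.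
- by rewrite -E => x /=; rewrite in_itv/= andbT => Tx; rewrite lee_fin H0.
- apply/disj_setPS => x [] /=; rewrite !in_itv/= andbT => /andP[_ xu] ux.
  by move: (lt_le_trans xu ux); rewrite ltxx.
have fI := fundamental_integrable_pinfty dFu cfu f0u Fl.
apply: lte_add_pinfty.
  apply: (@le_lt_trans _ _ (\int[mu]_(x in `[T, u]) (H x)%:E)%E).
    apply: ge0_subset_integral => //.
    - by apply: measurable_funS mH => //; exact: subset_itvl.
    - by move=> s /=; rewrite in_itv/= => /andP[Ts _]; rewrite lee_fin H0.
    - by apply: subset_itvl; rewrite bnd_simp.
  apply: integrable_lty => //.
  apply: within_continuous_integrable; apply: continuous_subspaceW cH.
  exact: subset_itvl.
apply: (@le_lt_trans _ _ (\int[mu]_(x in `[u, +oo[) (c%:E * (EFin \o f) x))%E).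
  apply: ge0_le_integral => //.
  - move=> x /=; rewrite in_itv/= andbT => ux; rewrite lee_fin H0//.
    exact: le_trans ux.
  - exact: measurable_funS mH.
  - apply: measurable_funeM; apply/measurable_EFinP.
    exact: continuous_measurable_ray.
  - by move=> x /=; rewrite in_itv/= andbT => /Hu[_ _ _ _ Hx]; rewrite -EFinM lee_fin.
by apply: integrable_lty => //; exact: integrableZl.
Unshelve. all: end_near. Qed.

End representation.

(** * Eventually equal functions and limits of monotone functions *)

Section eventual.
Context {R : realType}.
Implicit Types f g : R -> R.

(** Continuity and differentiability at [t] see a neighbourhood of [t]; this form lets them pass
    between eventually equal functions. *)
Lemma eventually_near (P : R -> Prop) : (\forall t \near +oo, P t) ->
  \forall t \near +oo, \forall s \near t, P s.
Proof.
move=> /eventually_exists[X HX]; near=> t.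
have Xt : X < t by near: t; apply: nbhs_pinfty_gt; rewrite num_real.
by have := lt_nbhsr Xt; apply: filterS => s /ltW; exact: HX.
Unshelve. all: end_near. Qed.

Lemma near_eq_continuous f g : (\forall t \near +oo, g t = f t) ->
  (\forall t \near +oo, {for t, continuous f}) ->
  \forall t \near +oo, {for t, continuous g}.
Proof.
move=> gf cf; have gf' := eventually_near gf; near=> t.
have gft : \forall s \near t, f s = g s.
  by have : \forall s \near t, g s = f s by [near: t]; apply: filterS => s ->.
have cft : {for t, continuous f} by near: t.
rewrite /prop_for /continuous_at (near gf t)//.
by apply: cvg_trans cft; exact: near_eq_cvg.
Unshelve. all: end_near. Qed.

Lemma near_eq_derive_at f g d : (\forall t \near +oo, f t = g t) ->
  (\forall t \near +oo, is_derive (t : R) 1 f (d t : R)) ->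
  \forall t \near +oo, is_derive (t : R) 1 g (d t).
Proof.
move=> fg df; have fg' := eventually_near fg; near=> t.
by apply: (@near_eq_is_derive _ _ _ f); near: t.
Unshelve. all: end_near. Qed.

Lemma eventually_nondecreasing_unbounded f :
  (exists c, forall x y, c <= x -> x <= y -> f x <= f y) ->
  ~ (exists B, \forall t \near +oo, f t <= B) -> f t @[t --> +oo] --> +oo.
Proof.
move=> [c fc] nB; apply/cvgryPge => A.
have [t ct At] : exists2 t, c <= t & A < f t.
  apply: contrapT => nt; apply: nB; exists A; near=> t.
  rewrite leNgt; apply/negP => At; apply: nt; exists t => //.
near=> s; rewrite (le_trans (ltW At))//; apply: fc => //.
Unshelve. all: end_near. Qed.

Lemma eventually_nondecreasing_bounded f (B : R) :
  (exists c, forall x y, c <= x -> x <= y -> f x <= f y) ->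
  (\forall t \near +oo, f t <= B) -> exists l : R, f t @[t --> +oo] --> l.
Proof.
move=> [c fc] /eventually_exists[X fB].
(* Freezing [f] to the left of [c] makes it monotone and bounded on the whole line without changing
   its limit. *)
pose F x := f (Num.max c x).
have Fl : F x @[x --> +oo] --> sup (range F).
  apply: nondecreasing_cvgr.
    move=> x y xy; apply: fc; first by rewrite le_max lexx.
    by rewrite ge_max le_max lexx/= le_max xy orbT.
  exists B => _ [x _ <-]; rewrite /F (@le_trans _ _ (f (Num.max X (Num.max c x))))//.
    by apply: fc; rewrite le_max lexx ?orbT.
  by apply: fB; rewrite le_max lexx.
exists (sup (range F)); apply: cvg_near_eq Fl; near=> t.
by rewrite /F max_r.
Unshelve. all: end_near. Qed.

Lemma limit_gt0 f (l : R) :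
  (exists c, forall x y, c <= x -> x <= y -> f x <= f y) ->
  (\forall t \near +oo, 0 < f t) -> f t @[t --> +oo] --> l -> 0 < l.
Proof.
move=> [c fc] /eventually_exists[X f0] fl.
have fM : 0 < f (Num.max c X) by apply: f0; rewrite le_max lexx orbT.
apply: (lt_le_trans fM); apply: (cvgr_to_ge fl); near=> t.
by apply: fc => //; rewrite le_max lexx.
Unshelve. all: end_near. Qed.

Lemma cvg_ln f (l : R) : 0 < l -> f t @[t --> +oo] --> l ->
  ln (f t) @[t --> +oo] --> ln l.
Proof. by move=> l0 fl; exact: (cvg_comp _ _ fl (continuous_ln l0)). Qed.

Lemma continuous_max_cst (u s : R) : {for s, continuous (fun x => Num.max x u)}.
Proof.
apply: (@continuous_max _ _ id (cst u)); [exact: cvg_id|exact: cst_continuous].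
Qed.

Lemma Phi_gt0E (alpha u : R) : 0 < u -> Phi alpha u = u `^ (alpha - 1).
Proof. by move=> u0; rewrite /Phi gtr0_sg// mul1r gtr0_norm. Qed.

Lemma Phi_le0 (alpha u : R) : u <= 0 -> Phi alpha u <= 0.
Proof. by move=> u0; rewrite mulr_le0_ge0 ?powR_ge0// sgr_le0. Qed.

End eventual.

(** * The half-linear equation *)

Section half_linear.
Context {R : realType}.
Variables (alpha beta delta K : R) (r p tau tau' : R -> R).

Hypothesis alpha_gt1 : 1 < alpha.
Hypothesis conj_ab : alpha^-1 + beta^-1 = 1.
Hypothesis delta_lt : delta < -1.
Hypothesis r_cont : \forall t \near +oo, {for t, continuous r}.
Hypothesis r_rv : regularly_varying (delta + alpha) r.
Hypothesis p_cont : \forall t \near +oo, {for t, continuous p}.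
Hypothesis p_rv : regularly_varying delta p.
Hypothesis tau_der : \forall t \near +oo, is_derive (t : R) 1 tau (tau' t).
Hypothesis tau'_cont : \forall t \near +oo, {for t, continuous tau'}.
Hypothesis tau'_gt0 : \forall t \near +oo, 0 < tau' t.
Hypothesis tau_infty : tau t @[t --> +oo] --> +oo.
Hypothesis tau_le : \forall t \near +oo, tau t <= t.
Hypothesis tau_ge : \forall t \near +oo, t <= K * tau t.

Let rho : R := (- 1 - delta) / (alpha - 1).
Let g t := r (tau t) `^ (1 - beta) * tau' t.
Let H := Htau alpha r p tau tau'.

Hypothesis g_rv : regularly_varying (delta * (1 - beta) - beta) g.
Hypothesis L_lim :
  (Lpart delta p t / Lpart (delta + alpha) r t) `^ (beta - 1) * tau' t
     @[t --> +oo] --> 0.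

Lemma alpha1_gt0 : 0 < alpha - 1. Proof. by rewrite subr_gt0. Qed.

Lemma beta_sub1 : beta - 1 = (alpha - 1)^-1.
Proof.
have a1 := alpha1_gt0; have a0 : 0 < alpha by exact: lt_trans alpha_gt1.
have -> : beta = (1 - alpha^-1)^-1 by rewrite -conj_ab addrC addKr invrK.
have : 1 - alpha^-1 = (alpha - 1) / alpha by field; rewrite gt_eqF.
by move=> ->; field; rewrite !gt_eqF.
Qed.

Lemma beta_sub1_gt0 : 0 < beta - 1.
Proof. by rewrite beta_sub1 invr_gt0 alpha1_gt0. Qed.

Lemma rho_gt0 : 0 < rho.
Proof. by apply: divr_gt0; [rewrite subr_gt0|exact: alpha1_gt0]. Qed.

Lemma betaE : beta = 1 + (alpha - 1)^-1.
Proof. by rewrite -beta_sub1; ring. Qed.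

(** With [rho_sub1_r]: the delayed coefficient [g] and [r ^ (1 - beta)] have the same index
    [rho - 1], so [z] and [y] will share the index [rho]. *)
Lemma rho_sub1 : delta * (1 - beta) - beta = rho - 1.
Proof. by rewrite betaE /rho; field; rewrite gt_eqF// alpha1_gt0. Qed.

Lemma rho_sub1_r : (delta + alpha) * (1 - beta) = rho - 1.
Proof. by rewrite betaE /rho; field; rewrite gt_eqF// alpha1_gt0. Qed.

Lemma powR_betaK x : 0 <= x -> (x `^ (beta - 1)) `^ (alpha - 1) = x.
Proof.
move=> x0; rewrite -powRrM beta_sub1 mulVf ?powRr1//.
by rewrite gt_eqF ?alpha1_gt0.
Qed.

Lemma powR_1betaK x : 0 <= x -> (x `^ (1 - beta)) `^ (alpha - 1) = x^-1.
Proof.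
move=> x0; rewrite -[1 - beta]opprB -powRrM beta_sub1 mulNr mulVf ?powR_inv1//.
by rewrite gt_eqF ?alpha1_gt0.
Qed.

Lemma powR_alphaK x : 0 <= x -> (x `^ (alpha - 1)) `^ (beta - 1) = x.
Proof. by move=> x0; rewrite powRAC powR_betaK. Qed.

Lemma r_gt0_tau : \forall t \near +oo, 0 < r (tau t).
Proof. by have [r0 _] := r_rv; exact: near_comp tau_infty r0. Qed.

Lemma tau_gt0 : \forall t \near +oo, 0 < tau t.
Proof. by move/cvgryPgt : tau_infty; exact. Qed.

Lemma tau_equiv f : (\forall t \near +oo, {for t, continuous f}) ->
  regularly_varying 0 f -> f t / f (tau t) @[t --> +oo] --> (1 : R).
Proof.
move=> cf f0; apply: (@slowly_varying_comp_equiv _ f tau id K) => //.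
by near=> t; rewrite (near tau_le t)// (near tau_ge t).
Unshelve. all: end_near. Qed.

Lemma Lr_equiv : Lpart (delta + alpha) r t / Lpart (delta + alpha) r (tau t)
  @[t --> +oo] --> (1 : R).
Proof.
apply: tau_equiv.
  near=> t; have t0 : 0 < t by [].
  apply: continuousM; first by near: t.
  apply: continuousV; first by rewrite gt_eqF// powR_gt0.
  exact: continuous_powR.
have := regularly_varyingM r_rv (regularly_varying_powR_id (- (delta + alpha))).
by rewrite subrr; apply: regularly_varying_eq; near=> t; rewrite powRN.
Unshelve. all: end_near. Qed.

Lemma tH_cvg0 : t * H t @[t --> +oo] --> 0.
Proof.
have [r0 _] := r_rv; have [p0 _] := p_rv.
pose c := delta + alpha.
pose X t := (Lpart delta p t / Lpart c r t) `^ (beta - 1) * tau' t.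
have Lr1 := near_cvg_lt Lr_equiv (ltr1n R 2).
have X0 : X t `^ (alpha - 1) @[t --> +oo] --> 0.
  apply: (cvg_powR_zero alpha1_gt0); last exact: L_lim.
  by near=> t; rewrite mulr_ge0 ?powR_ge0// ltW//; near: t.
(* Since [t / tau t] lies in [[1, K]], the bound with exponent [|c|] serves for either sign of [c];
   the factor 2 bounds the quotient of the two values of the slowly varying part of [r]. *)
apply: (cvg_zero_bounded (B := K `^ `|c| * 2) _ X0).
near=> t.
have t0 : 0 < t by [].
have rt : 0 < r t by near: t.
have pt : 0 < p t by near: t.
have tau't : 0 < tau' t by near: t.
have taut : 0 < tau t by near: t; exact: tau_gt0.
have rtaut : 0 < r (tau t) by near: t; exact: r_gt0_tau.
have tHE : t * H t = X t `^ (alpha - 1) *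
    ((t / tau t) `^ c * (Lpart c r t / Lpart c r (tau t))).
  have Lp0 : 0 < Lpart delta p t by rewrite divr_gt0// powR_gt0.
  have Lr0 : 0 < Lpart c r t by rewrite divr_gt0// powR_gt0.
  rewrite /X powRM ?powR_ge0 ?(ltW tau't)// powR_betaK ?(ltW (divr_gt0 Lp0 Lr0))//.
  rewrite /H /Htau powRM ?ltW// powR_div// /Lpart.
  have -> : t `^ c = t `^ delta * (t `^ (alpha - 1) * t).
    rewrite -[X in _ * (_ * X)]powRr1 ?ltW// -!powRD_gt0//.
    by congr (_ `^ _); rewrite /c; ring.
  have t1 : 0 < t `^ delta by exact: powR_gt0.
  have t2 : 0 < tau t `^ c by exact: powR_gt0.
  have t3 : 0 < t `^ (alpha - 1) by exact: powR_gt0.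
  by field; rewrite !gt_eqF.
have Lrt : 0 < Lpart c r t / Lpart c r (tau t).
  by rewrite divr_gt0// divr_gt0// powR_gt0.
have tt0 : 0 < t / tau t by exact: divr_gt0.
rewrite tHE normrM mulrC ler_wpM2r// gtr0_norm; last first.
  by rewrite mulr_gt0// powR_gt0.
rewrite ler_pM ?powR_ge0 ?(ltW Lrt)//; last first.
  by rewrite ltW//; near: t.
have t1 : 1 <= t / tau t by rewrite ler_pdivlMr// mul1r; near: t.
rewrite (@le_trans _ _ ((t / tau t) `^ `|c|))//.
  by rewrite ler_powR// ler_norm.
have tK : t / tau t <= K by rewrite ler_pdivrMr//; near: t.
by rewrite ge0_ler_powR// nnegrE ?(le_trans (ltW tt0) tK) ?(ltW tt0).
Unshelve. all: end_near. Qed.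

Lemma tau_cont : \forall t \near +oo, {for t, continuous tau}.
Proof. by apply: filterS tau_der => t; exact: is_derive_continuous. Qed.

Lemma g_gt0 : \forall t \near +oo, 0 < g t.
Proof. by have [] := g_rv. Qed.

Lemma g_cont : \forall t \near +oo, {for t, continuous g}.
Proof.
have rc := near_comp tau_infty r_cont.
have r0 := r_gt0_tau.
near=> t; apply: continuousM; last by near: t.
apply: continuous_for_powR; last by near: t.
apply: continuous_for_comp; last by near: t.
by near: t; exact: tau_cont.
Unshelve. all: end_near. Qed.

Lemma g_powE : \forall t \near +oo, g t `^ (alpha - 1) =
  tau' t `^ (alpha - 1) / r (tau t).
Proof.
have r0 := r_gt0_tau; near=> t.
have r0t : 0 < r (tau t) by near: t.
have tau't : 0 < tau' t by near: t.
by rewrite /g powRM ?powR_ge0 ?ltW// powR_1betaK ?ltW// mulrC.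
Unshelve. all: end_near. Qed.

(** In this form a bound of [z] by a multiple of [q ^ (beta - 1) * (t * g)] becomes a bound of
    [q' / q] by a multiple of [H]. *)
Lemma HE : \forall t \near +oo, H t = p t * (t * g t) `^ (alpha - 1).
Proof.
have gE := g_powE; have g0 := g_gt0; near=> t.
have t0 : 0 < t by [].
have gt : 0 < g t by near: t.
have tau't : 0 < tau' t by near: t.
rewrite powRM ?ltW// (near gE t)// /H /Htau powRM ?ltW//.
by ring.
Unshelve. all: end_near. Qed.

(** * One increasing solution: slow variation of [q] and its consequences *)

Section solution.
Variables y dy : R -> R.
(** As [dy] is eventually positive, [Phi] reduces to a power. For large [t] this [q] is the
    quasiderivative, an identification postponed to [quasiE]. *)
Let q t := r t * dy t `^ (alpha - 1).
Let z t := y (tau t).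
Let dq t := p t * z t `^ (alpha - 1).

Hypothesis y_der : \forall t \near +oo, is_derive (t : R) 1 y (dy t).
Hypothesis y_gt0 : \forall t \near +oo, 0 < y t.
Hypothesis dy_gt0 : \forall t \near +oo, 0 < dy t.
Hypothesis dy_cont : \forall t \near +oo, {for t, continuous dy}.
Hypothesis q_der : \forall t \near +oo, is_derive (t : R) 1 q (dq t).

Lemma q_gt0 : \forall t \near +oo, 0 < q t.
Proof.
have [r0 _] := r_rv; near=> t; rewrite mulr_gt0 ?powR_gt0//; near: t => //.
Unshelve. all: end_near. Qed.

Lemma z_gt0 : \forall t \near +oo, 0 < z t.
Proof. exact: near_comp tau_infty y_gt0. Qed.

Lemma dq_gt0 : \forall t \near +oo, 0 < dq t.
Proof.
have [p0 _] := p_rv; have z0 := z_gt0.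
by near=> t; rewrite mulr_gt0 ?powR_gt0//; near: t.
Unshelve. all: end_near. Qed.

Lemma q_cont : \forall t \near +oo, {for t, continuous q}.
Proof. by apply: filterS q_der => t; exact: is_derive_continuous. Qed.

Lemma dyE : \forall t \near +oo, dy t = q t `^ (beta - 1) * r t `^ (1 - beta).
Proof.
have [r0 _] := r_rv; near=> t.
have rt : 0 < r t by near: t.
have dyt : 0 < dy t by near: t.
rewrite /q powRM ?powR_ge0 ?ltW// powR_alphaK ?ltW// mulrAC -powRD_gt0//.
by rewrite (_ : beta - 1 + (1 - beta) = 0) ?powRr0 ?mul1r//; ring.
Unshelve. all: end_near. Qed.

Lemma z_der : \forall t \near +oo,
  is_derive (t : R) 1 z (q (tau t) `^ (beta - 1) * g t).
Proof.
have yt := near_comp tau_infty y_der; have dyt := near_comp tau_infty dyE.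
near=> t; rewrite /g mulrA -(near dyt t)//.
by apply: is_derive1_comp; near: t.
Unshelve. all: end_near. Qed.

Lemma q_nondecreasing : exists c, forall x y, c <= x -> x <= y -> q x <= q y.
Proof.
have [c Hc] : exists c : R, forall x : R, c <= x ->
    is_derive x 1 q (dq x) /\ 0 < dq x.
  by apply: eventually_exists; have dq0 := dq_gt0; near=> t; split; near: t.
exists c; apply: (@nneg_derive_nondecreasing _ q dq) => x /Hc[]// _ /ltW.
by [].
Unshelve. all: end_near. Qed.

(** Relative to a primitive [G] of [g], the derivative of [z] is [q (tau t) ^ (beta - 1)], which is
    nondecreasing; the increment of [z] is therefore at most its final value times [G t]. Nothing
    about the growth of [q] is used. *)
Lemma z_le : exists2 C : R, 0 < C &
  \forall t \near +oo, z t <= C * (q t `^ (beta - 1) * (t * g t)).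
Proof.
have [G dG] := eventual_primitive g_cont.
have g_rv1 : regularly_varying (rho - 1) g by rewrite -rho_sub1.
have Gy := regularly_varying_primitive_pinfty rho_gt0 dG g_rv1.
have Gk := karamata rho_gt0 dG g_cont g_rv1.
have rho2 : rho / 2 < rho by rewrite ltr_pdivrMr// ltr_pMr ?rho_gt0// ltr1n.
have Gg := near_cvg_gt Gk rho2.
have [c Hc] := q_nondecreasing.
have g0 := g_gt0; have q0 := near_comp tau_infty q_gt0.
have zd := z_der.
have tc := near_comp tau_infty
  (nbhs_pinfty_ge (num_real c) : \forall t \near +oo, c <= t).
have [X0 tauder] := eventually_exists tau_der.
have [X1 tau'0] := eventually_exists tau'_gt0.
have G0 : \forall t \near +oo, 0 < G t by move/cvgryPgt : Gy; exact.
have [b Hb] : exists b : R, forall t : R, b <= t -> [/\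
   is_derive t 1 z (q (tau t) `^ (beta - 1) * g t), is_derive t 1 G (g t),
   0 < g t, 0 < q (tau t) & [/\ c <= tau t, 0 < G t, X0 <= t & X1 <= t]].
  apply: eventually_exists; near=> t.
  by split; [| | | |split]; near: t => //; apply: nbhs_pinfty_ge; rewrite num_real.
have [_ _ _ qb [cb Gb _ _]] := Hb _ (lexx b).
have tauincr : forall x y, b <= x -> x <= y -> tau x <= tau y.
  apply: (@nneg_derive_nondecreasing _ tau tau') => x /Hb[_ _ _ _ [_ _ H0 H1]].
    exact: tauder.
  by rewrite ltW// tau'0.
(* Of the factor 2, one unit pays for the initial value [z b], negligible because [G] is unbounded,
   and the other for the increment. *)
have bz : \forall t \near +oo, z t <= 2 * (q (tau t) `^ (beta - 1) * G t).
  have /cvgryPge /(_ (z b / q (tau b) `^ (beta - 1))) Gbig := Gy.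
  near=> t.
  have bt : b < t by near: t; apply: nbhs_pinfty_gt; rewrite num_real.
  have [_ _ _ qt [_ Gt _ _]] := Hb _ (ltW bt).
  have [|||x /andP[bx xt] zE] := @cauchy_mean_value _ z G
    (fun t => q (tau t) `^ (beta - 1) * g t) g b _ _ _ b t (lexx b) bt.
  - by move=> x /Hb[].
  - by move=> x /Hb[].
  - by move=> x /Hb[_ _ /gt_eqF ->].
  have [_ _ gx qx _] := Hb _ bx.
  have mono s u : b <= s -> s <= u ->
      q (tau s) `^ (beta - 1) <= q (tau u) `^ (beta - 1).
    move=> bs su; have [_ _ _ qs [cs _ _ _]] := Hb _ bs.
    have [_ _ _ qu _] := Hb _ (le_trans bs su).
    rewrite ge0_ler_powR ?nnegrE ?(ltW qs) ?(ltW qu) ?(ltW beta_sub1_gt0)//.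
    by apply: Hc => //; exact: tauincr.
  have zb : z b <= q (tau t) `^ (beta - 1) * G t.
    apply: (@le_trans _ _ (q (tau b) `^ (beta - 1) * G t)).
      by rewrite mulrC -ler_pdivrMr ?powR_gt0//; near: t.
    by apply: ler_wpM2r (ltW Gt) _ _ _; apply: mono => //; exact: ltW.
  have -> : z t = z b + (z t - z b) by ring.
  rewrite zE mulfK ?gt_eqF// mulrDl mul1r lerD//.
  apply: (@le_trans _ _ (q (tau x) `^ (beta - 1) * G t)).
    by apply: ler_wpM2l; rewrite ?powR_ge0// lerBlDr lerDl ltW.
  by apply: ler_wpM2r (ltW Gt) _ _ _; exact: mono.
have rho0 := rho_gt0.
(* The 2 from [bz] times [2 / rho], since Karamata gives [t * g t / G t > rho / 2] eventually. *)
exists (4 / rho); first by rewrite divr_gt0.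
near=> t.
have t0 : 0 < t by [].
have Gt : 0 < G t by near: t.
have gt : 0 < g t by near: t.
have qt : 0 < q (tau t) by near: t.
have ct : c <= tau t by near: t.
have : z t <= 2 * (q (tau t) `^ (beta - 1) * G t) by near: t.
move/le_trans; apply.
have : rho / 2 < t * g t / G t by near: t.
rewrite ltr_pdivlMr// => /ltW GG.
have -> : 4 / rho * (q t `^ (beta - 1) * (t * g t)) =
   2 * (q t `^ (beta - 1) * (2 / rho * (t * g t))) by field; rewrite gt_eqF.
apply: ler_wpM2l => //.
apply: ler_pM; [exact: powR_ge0|exact: ltW| |].
  have qtt : q (tau t) <= q t by apply: Hc => //; near: t.
  by rewrite ge0_ler_powR ?nnegrE ?(ltW beta_sub1_gt0) ?(ltW qt)// (le_trans (ltW qt)).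
rewrite (_ : G t = 2 / rho * (rho / 2 * G t)).
  by rewrite ler_pM2l// divr_gt0.
by field; rewrite gt_eqF.
Unshelve. all: end_near. Qed.

(** The exponents [alpha - 1] and [beta - 1] are reciprocal, so raising the bound of [z] to the
    power [alpha - 1] produces exactly one factor [q t], which cancels. *)
Lemma q_log_derivative : t * dq t / q t @[t --> +oo] --> 0.
Proof.
have [C C0 zC] := z_le.
apply: (cvg_zero_bounded (B := C `^ (alpha - 1)) _ tH_cvg0).
have q0 := q_gt0; have z0 := z_gt0; have g0 := g_gt0.
have [p0 _] := p_rv; have HEt := HE.
near=> t.
have t0 : 0 < t by [].
have qt : 0 < q t by near: t.
have zt : 0 < z t by near: t.
have gt : 0 < g t by near: t.
have pt : 0 < p t by near: t.
have tgt : 0 < t * g t by exact: mulr_gt0.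
have zpt : 0 < z t `^ (alpha - 1) by exact: powR_gt0.
have tgpt : 0 < (t * g t) `^ (alpha - 1) by exact: powR_gt0.
rewrite (near HEt t)// gtr0_norm; last first.
  by apply: divr_gt0 => //; apply: mulr_gt0 => //; exact: mulr_gt0.
rewrite gtr0_norm; last by apply: mulr_gt0 => //; exact: mulr_gt0.
have -> : C `^ (alpha - 1) * (t * (p t * (t * g t) `^ (alpha - 1))) =
  t * (p t * (C * (q t `^ (beta - 1) * (t * g t))) `^ (alpha - 1)) / q t.
  have qtg : 0 <= q t `^ (beta - 1) * (t * g t).
    by apply: mulr_ge0; [exact: powR_ge0|exact: ltW].
  rewrite (powRM _ (ltW C0) qtg) (powRM _ (powR_ge0 _ _) (ltW tgt)).
  by rewrite powR_betaK ?(ltW qt)//; field; rewrite gt_eqF.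
rewrite ler_pM2r ?invr_gt0// ler_pM2l// ler_pM2l//.
have : z t <= C * (q t `^ (beta - 1) * (t * g t)) by near: t.
move=> zt'.
by rewrite ge0_ler_powR ?nnegrE ?(ltW alpha1_gt0) ?(ltW zt)// (le_trans (ltW zt)).
Unshelve. all: end_near. Qed.

Lemma q_slowly_varying : regularly_varying 0 q.
Proof. exact: normalized_regularly_varying q_der q_gt0 q_log_derivative. Qed.

Lemma dy_rv : regularly_varying (rho - 1) dy.
Proof.
have := regularly_varyingM (regularly_varying_powR (beta - 1) q_slowly_varying)
  (regularly_varying_powR (1 - beta) r_rv).
rewrite mul0r add0r rho_sub1_r; apply: regularly_varying_eq.
by apply: filterS dyE => t.
Qed.

Lemma y_index : t * dy t / y t @[t --> +oo] --> rho.
Proof. exact: karamata rho_gt0 y_der dy_cont dy_rv. Qed.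

Lemma y_pinfty : y t @[t --> +oo] --> +oo.
Proof. exact: regularly_varying_primitive_pinfty rho_gt0 y_der dy_rv. Qed.

Lemma q_tau_equiv : q t / q (tau t) @[t --> +oo] --> (1 : R).
Proof. exact: tau_equiv q_cont q_slowly_varying. Qed.

Lemma q_tau_slowly_varying : regularly_varying 0 (fun t => q (tau t)).
Proof.
apply: (regularly_varying_equiv (c := 1) ltr01 q_slowly_varying).
have := cvgyV (oner_neq0 R) q_tau_equiv; rewrite invr1.
by apply: cvg_near_eq; near=> t; rewrite invf_div.
Unshelve. all: end_near. Qed.

Lemma dz_rv : regularly_varying (rho - 1) (fun t => q (tau t) `^ (beta - 1) * g t).
Proof.
have := regularly_varyingM
  (regularly_varying_powR (beta - 1) q_tau_slowly_varying) g_rv.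
by rewrite mul0r add0r rho_sub1.
Qed.

Lemma dz_cont : \forall t \near +oo,
  {for t, continuous (fun t => q (tau t) `^ (beta - 1) * g t)}.
Proof.
have qc := near_comp tau_infty q_cont; have q0 := near_comp tau_infty q_gt0.
have gc := g_cont.
near=> t; apply: continuousM; last by near: t.
apply: continuous_for_powR; last by near: t.
apply: continuous_for_comp; last by near: t.
by near: t; exact: tau_cont.
Unshelve. all: end_near. Qed.

Lemma z_index :
  t * (q (tau t) `^ (beta - 1) * g t) / z t @[t --> +oo] --> rho.
Proof. exact: karamata rho_gt0 z_der dz_cont dz_rv. Qed.

(** The quotient equals [(z t / (t * z' t)) ^ (alpha - 1)] times [q (tau t) / q t]. The first factor
    is known from [z_index], the second tends to 1 because the delay is invisible to the slowly
    varying [q]. *)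
Lemma log_derivative_equiv :
  dq t / q t / H t @[t --> +oo] --> (rho `^ (alpha - 1))^-1.
Proof.
have rho0 : rho != 0 by rewrite gt_eqF// rho_gt0.
have zi : z t / (t * (q (tau t) `^ (beta - 1) * g t)) @[t --> +oo] --> rho^-1.
  have := cvgyV rho0 z_index; apply: cvg_near_eq; near=> t.
  by rewrite invf_div.
have rhoi : 0 < rho^-1 by rewrite invr_gt0 rho_gt0.
have zip : (z t / (t * (q (tau t) `^ (beta - 1) * g t))) `^ (alpha - 1)
    @[t --> +oo] --> rho^-1 `^ (alpha - 1).
  exact: cvg_powR rhoi zi.
have := cvgyM zip (cvgyV (oner_neq0 R) q_tau_equiv).
have -> : rho^-1 `^ (alpha - 1) / 1 = (rho `^ (alpha - 1))^-1.
  rewrite -[rho^-1]mul1r powR_div ?rho_gt0// powR1 mul1r.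
  by rewrite invr1 mulr1.
apply: cvg_near_eq.
have q0 := q_gt0; have qt0 := near_comp tau_infty q_gt0.
have z0 := z_gt0; have g0 := g_gt0; have HEt := HE; have [p0 _] := p_rv.
near=> t.
have t0 : 0 < t by [].
have qt : 0 < q t by near: t.
have qtt : 0 < q (tau t) by near: t.
have zt : 0 < z t by near: t.
have gt : 0 < g t by near: t.
have pt : 0 < p t by near: t.
have tgt : 0 < t * g t by exact: mulr_gt0.
have tg : 0 < (t * g t) `^ (alpha - 1) by exact: powR_gt0.
rewrite (near HEt t)// mulrCA powR_div//; last first.
  by apply: mulr_gt0 => //; exact: powR_gt0.
rewrite (powRM _ (powR_ge0 _ _) (ltW tgt)) powR_betaK ?(ltW qtt)// /dq.
by field; rewrite !gt_eqF.
Unshelve. all: end_near. Qed.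

Lemma z_rv : regularly_varying rho z.
Proof. exact: normalized_regularly_varying z_der z_gt0 z_index. Qed.

(** The exponent [rho] is the one for which [delta + rho * (alpha - 1) = -1], the borderline index
    at which de Haan's theorem applies. *)
Lemma dq_rv : regularly_varying (-1) dq.
Proof.
have := regularly_varyingM p_rv (regularly_varying_powR (alpha - 1) z_rv).
suff -> : delta + rho * (alpha - 1) = -1 by [].
by rewrite /rho; field; rewrite gt_eqF// alpha1_gt0.
Qed.

Lemma dq_cont : \forall t \near +oo, {for t, continuous dq}.
Proof.
have zd := z_der; have z0 := z_gt0.
near=> t; apply: continuousM; first by near: t.
apply: continuous_for_powR; last by near: t.
by near: t; apply: filterS zd => s; exact: is_derive_continuous.
Unshelve. all: end_near. Qed.

Lemma quasi_de_haan l : 0 < l ->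
  (q (l * t) - q t) / (t * dq t) @[t --> +oo] --> ln l.
Proof. by move=> l0; exact: de_haan_ln q_der dq_cont dq_rv _ l0. Qed.

Lemma quasi_remainder (M : R) : 0 < M -> q t @[t --> +oo] --> M ->
  regularly_varying 0 (fun t => M - q t) /\
  t `^ (delta + alpha) * tau' t `^ (alpha - 1) * Lpart delta p t /
    (tau t `^ (delta + alpha) * Lpart (delta + alpha) r t * (M - q t))
    @[t --> +oo] --> 0.
Proof.
move=> M0 qM.
have [Mq0 Mq] := slowly_varying_remainder q_der dq_cont dq_rv qM.
split => //.
have rhoa : (rho `^ (alpha - 1))^-1 != 0.
  by rewrite invr_eq0 gt_eqF// powR_gt0// rho_gt0.
(* The expression is [t * H t / (M - q t)] times the quotient of the slowly varying parts of [r] at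
   [tau t] and at [t]. Trading [H] for [dq / q] costs the limit of their ratio and the factor [q],
   which tends to [M]; only [t * dq t / (M - q t)] tends to 0. *)
have L1 := cvgyM (cvgyM (cvgyM Mq (cvgyV rhoa log_derivative_equiv))
  (cvgyV (lt0r_neq0 M0) qM)) (cvgyV (oner_neq0 R) Lr_equiv).
rewrite !mul0r in L1; apply: cvg_near_eq L1.
have q0 := q_gt0; have d0 := dq_gt0.
have [r0 _] := r_rv; have [p0 _] := p_rv; have [Mq_gt0 _] := Mq0.
have tau0 := tau_gt0; have rt0 := r_gt0_tau.
near=> t.
have t0 : 0 < t by [].
have qt : 0 < q t by near: t.
have dqt : 0 < dq t by near: t.
have rt : 0 < r t by near: t.
have pt : 0 < p t by near: t.
have tau't : 0 < tau' t by near: t.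
have taut : 0 < tau t by near: t.
have rtaut : 0 < r (tau t) by near: t.
have Mqt : 0 < M - q t by near: t.
have ptau : 0 < tau' t `^ (alpha - 1) by exact: powR_gt0.
have p1 : 0 < t `^ delta by exact: powR_gt0.
have p2 : 0 < tau t `^ (delta + alpha) by exact: powR_gt0.
have p3 : 0 < t `^ (alpha - 1) by exact: powR_gt0.
rewrite /H /Htau /Lpart powRM ?ltW//.
have -> : t `^ (delta + alpha) = t `^ delta * (t `^ (alpha - 1) * t).
  rewrite -[X in _ * (_ * X)]powRr1 ?ltW// -!powRD_gt0//.
  by congr (_ `^ _); ring.
by field; rewrite !gt_eqF.
Unshelve. all: end_near. Qed.


Hypothesis quasiE : \forall t \near +oo, quasi alpha r y t = q t.

(** The logarithm of [q ^ (beta - 1)], the slowly varying factor of [y']; it supplies the exponents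
    of both formulae. *)
Let logq t := (beta - 1) * ln (q t).
Let dlogq t := (beta - 1) * (dq t / q t).

Lemma y_NRV : NRV rho y.
Proof. exact: normalized_NRV y_der dy_cont y_gt0 y_index. Qed.

Lemma quasi_cont : \forall t \near +oo, {for t, continuous (quasi alpha r y)}.
Proof.
apply: near_eq_continuous q_cont.
by apply: filterS quasiE => t ->.
Qed.

Lemma quasi_Pi :
  Pi_class (fun t => t * p t * Phi alpha (y (tau t))) (quasi alpha r y).
Proof.
have wE : \forall t \near +oo, t * p t * Phi alpha (y (tau t)) = t * dq t.
  have z0 := z_gt0; near=> t.
  by rewrite Phi_gt0E -?mulrA//; near: t.
split.
- have [X cX] := eventually_exists quasi_cont.
  by exists X; exact: continuous_measurable_ray.
- have dq0 := dq_gt0; near=> t; rewrite (near wE t)// mulr_gt0//; near: t => //.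
- move=> l l0; apply: cvg_near_eq (quasi_de_haan l0).
  have quasiEl := near_scale l0 quasiE.
  near=> t; rewrite (near wE t)//.
  have -> : quasi alpha r y t = q t by near: t.
  by have -> : quasi alpha r y (l * t) = q (l * t) by near: t.
Unshelve. all: end_near. Qed.

Lemma expR_logq t : 0 < q t -> expR (logq t) = q t `^ (beta - 1).
Proof. by move=> qt; rewrite /powR gt_eqF. Qed.

Lemma logq_der : \forall t \near +oo, is_derive (t : R) 1 logq (dlogq t).
Proof.
have q0 := q_gt0; near=> t.
have qt : 0 < q t by near: t.
have d1 : is_derive t 1 (@ln R \o q) ((q t)^-1 * dq t).
  apply: is_derive1_comp; first exact: is_derive1_ln.
  by near: t.
by have := is_deriveZ (beta - 1) d1; rewrite /dlogq [dq t / _]mulrC.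
Unshelve. all: end_near. Qed.

Lemma dlogq_cont : \forall t \near +oo, {for t, continuous dlogq}.
Proof.
have q0 := q_gt0; have dqc := dq_cont; have qc := q_cont; near=> t.
have qt : 0 < q t by near: t.
apply: continuousM; first exact: cst_continuous.
apply: continuousM; first by near: t.
by apply: continuousV; [rewrite gt_eqF|near: t].
Unshelve. all: end_near. Qed.

Lemma dlogq_gt0 : \forall t \near +oo, 0 < dlogq t.
Proof.
have q0 := q_gt0; have dq0 := dq_gt0; near=> t.
apply: mulr_gt0; first exact: beta_sub1_gt0.
by apply: divr_gt0; near: t.
Unshelve. all: end_near. Qed.

Let k := (beta - 1) / rho `^ (alpha - 1).

Lemma k_gt0 : 0 < k.
Proof. by rewrite divr_gt0 ?beta_sub1_gt0// powR_gt0// rho_gt0. Qed.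

Lemma dlogq_equiv : dlogq t / (k * H t) @[t --> +oo] --> (1 : R).
Proof.
have rhoa : 0 < rho `^ (alpha - 1) by rewrite powR_gt0// rho_gt0.
have := cvgyM log_derivative_equiv (cvgy_cst (rho `^ (alpha - 1))).
rewrite mulVf ?gt_eqF//; apply: cvg_near_eq.
have b0 := beta_sub1_gt0; near=> t.
(* At a zero of [H] both sides are 0, by the convention that the inverse of 0 is 0. *)
have [H0|H0] := eqVneq (H t) 0; first by rewrite H0 mulr0 invr0 !mulr0 mul0r.
rewrite /dlogq /k; set x := dq t / q t.
by field; rewrite H0 !gt_eqF.
Unshelve. all: end_near. Qed.

(** * The two formulae, and the dichotomy between unbounded and convergent [q] *)

Section integrals.
Variable T : R.
Hypothesis H_gt0 : forall t, T <= t -> 0 < H t.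

Lemma kH_neq0 t : T <= t -> k * H t != 0.
Proof. by move=> Tt; rewrite gt_eqF// mulr_gt0 ?k_gt0// H_gt0. Qed.

Lemma y_formula_infinite : formula_infinite alpha beta rho T r H y.
Proof.
have rho0 := rho_gt0.
(* With the constant [ln rho] the right-hand side becomes [t * y' t / rho], which is asymptotic to
   [y] by [y_index]. *)
have [eps [eps0 epsI epsE]] := exponent_representation (ln rho) kH_neq0 logq_der
  dlogq_cont dlogq_equiv.
pose e t := t * r t `^ (1 - beta) * expR (\int[lebesgue_measure]_(s in `[T, t])
  ((1 + eps s) * ((beta - 1) / Phi alpha rho) * H s)).
exists eps, (fun t => y t / e t - 1); rewrite Phi_gt0E//; split => //.
  have := cvgyM (cvgy_cst rho) (cvgyV (lt0r_neq0 rho0) y_index).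
  rewrite divff ?gt_eqF// => L; rewrite -(subrr 1).
  apply: cvgyB (cvgy_cst 1); apply: cvg_near_eq L.
  have q0 := q_gt0; have dyE' := dyE.
  near=> t.
  have t0 : 0 < t by [].
  have qt : 0 < q t by near: t.
  have dyt : 0 < dy t by near: t.
  have yt : 0 < y t by near: t.
  rewrite /e Phi_gt0E//.
  have -> : \int[lebesgue_measure]_(s in `[T, t])
      ((1 + eps s) * ((beta - 1) / rho `^ (alpha - 1)) * H s) = logq t - ln rho.
    by near: t.
  rewrite expRB lnK ?posrE// expR_logq//.
  have -> : t * r t `^ (1 - beta) * (q t `^ (beta - 1) / rho) = t * dy t / rho.
    have -> : dy t = q t `^ (beta - 1) * r t `^ (1 - beta) by near: t.
    by field; rewrite gt_eqF.
  by field; rewrite !gt_eqF.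
have [r0 _] := r_rv.
near=> t.
have t0 : 0 < t by [].
have rt : 0 < r t `^ (1 - beta) by rewrite powR_gt0//; near: t.
rewrite -/k [1 + _]addrC subrK /e Phi_gt0E// -/k divfK//.
by rewrite gt_eqF// mulr_gt0 ?expR_gt0// mulr_gt0.
Unshelve. all: end_near. Qed.

Hypothesis H_cont : {within `[T, +oo[, continuous H}.

(** A bounded [q] would converge to a positive limit, so its logarithm would converge; as [H] is
    eventually at most [2 / k] times the derivative [dlogq], its integral would be finite. *)
Lemma quasi_unbounded :
  (\int[lebesgue_measure]_(s in `[T, +oo[) (H s)%:E = +oo)%E ->
  quasi alpha r y t @[t --> +oo] --> +oo.
Proof.
move=> HI; suff : q t @[t --> +oo] --> +oo.
  move/cvgryPge => qy; apply/cvgryPge => A; have qA := qy A.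
  by near=> t; rewrite (near quasiE t)//; near: t.
have [[B qB]|nB] := pselect (exists B, \forall t \near +oo, q t <= B); last first.
  exact: eventually_nondecreasing_unbounded q_nondecreasing nB.
have [l ql] := eventually_nondecreasing_bounded q_nondecreasing qB.
have l0 : 0 < l by exact: limit_gt0 q_nondecreasing q_gt0 ql.
have logql : logq t @[t --> +oo] --> (beta - 1) * ln l.
  exact: cvgyM (cvgy_cst _) (cvg_ln l0 ql).
have : (\int[lebesgue_measure]_(s in `[T, +oo[) (H s)%:E < +oo)%E.
  have half1 : 2^-1 < 1 :> R by rewrite invf_lt1// ltr1n.
  have eq := near_cvg_gt dlogq_equiv half1.
  have dl0 := dlogq_gt0; have k0 := k_gt0.
  apply: (@integral_ray_finite _ T (2 / k) ((beta - 1) * ln l) _ dlogq logq) => //.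
  - by move=> t Tt; rewrite ltW// H_gt0.
  - exact: logq_der.
  - exact: dlogq_cont.
  - by apply: filterS dl0 => t /ltW.
  near=> t.
  have Ht : 0 < H t by apply: H_gt0; near: t; apply: nbhs_pinfty_ge; rewrite num_real.
  have : 2^-1 < dlogq t / (k * H t) by near: t.
  have kHt : 0 < k * H t by exact: mulr_gt0.
  rewrite ltr_pdivlMr// => /ltW Hl.
  have -> : H t = 2 / k * (2^-1 * (k * H t)) by field; rewrite gt_eqF.
  by apply: ler_wpM2l => //; apply: divr_ge0 => //; exact: ltW.
by rewrite HI ltxx.
Unshelve. all: end_near. Qed.

Lemma quasi_bounded :
  (\int[lebesgue_measure]_(s in `[T, +oo[) (H s)%:E < +oo)%E ->
  exists2 M : R, 0 < M & q t @[t --> +oo] --> M.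
Proof.
move=> HI; have k0 := k_gt0.
have eq := near_cvg_lt dlogq_equiv (ltr1n R 2).
have mH : measurable_fun `[T, +oo[ H by exact: subspace_continuous_measurable_fun.
have H0 t : T <= t -> 0 <= H t by move=> Tt; rewrite ltW// H_gt0.
have HB : \forall t \near +oo, dlogq t <= 2 * k * H t.
  near=> t.
  have Ht : 0 < H t by apply: H_gt0; near: t; apply: nbhs_pinfty_ge; rewrite num_real.
  have : dlogq t / (k * H t) < 2 by near: t.
  have kHt : 0 < k * H t by exact: mulr_gt0.
  by rewrite ltr_pdivrMr// mulrA => /ltW.
have [B logqB] := primitive_bounded mH H0 HI logq_der dlogq_cont HB.
have q0 := q_gt0; have b0 := beta_sub1_gt0.
have qB : \forall t \near +oo, q t <= expR (B / (beta - 1)).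
  near=> t.
  have qt : 0 < q t by near: t.
  have : logq t <= B by near: t.
  by rewrite -[in X in _ -> X <= _](lnK qt) ler_expR ler_pdivlMr// mulrC.
have [M qM] := eventually_nondecreasing_bounded q_nondecreasing qB.
by exists M => //; exact: limit_gt0 q_nondecreasing q_gt0 qM.
Unshelve. all: end_near. Qed.

Hypothesis r_gt0_ray : forall t, T <= t -> 0 < r t.
Hypothesis r_cont_ray : {within `[T, +oo[, continuous r}.

Lemma y_formula_finite (M : R) : 0 < M -> q t @[t --> +oo] --> M ->
  formula_finite alpha beta rho T M r H y.
Proof.
move=> M0 qM.
have q0 := q_gt0; have qc := q_cont; have dl := logq_der; have dlc := dlogq_cont.
have dl0 := dlogq_gt0; have dyE' := dyE.
have [u Hu] : exists u : R, forall t : R, u <= t -> [/\ T <= t, 0 < q t,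
    {for t, continuous q}, dy t = q t `^ (beta - 1) * r t `^ (1 - beta) &
    [/\ is_derive t 1 logq (dlogq t), {for t, continuous dlogq}, 0 < dlogq t,
        is_derive t 1 y (dy t) & {for t, continuous dy}]].
  apply: eventually_exists; near=> t.
  by split; [| | | |split]; near: t => //; apply: nbhs_pinfty_ge; rewrite num_real.
have [Tu _ _ _ _] := Hu _ (lexx u).
have logqM : logq t @[t --> +oo] --> (beta - 1) * ln M.
  exact: cvgyM (cvgy_cst _) (cvg_ln M0 qM).
have dlu t : u <= t -> is_derive t 1 logq (dlogq t) by move=> /Hu[_ _ _ _ []].
have dlcu t : u <= t -> {for t, continuous dlogq} by move=> /Hu[_ _ _ _ []].
have dl0u t : u <= t -> 0 <= dlogq t by move=> /Hu[_ _ _ _ [_ _ /ltW]].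
have [eps [eps0 epsI epsE]] :=
  tail_representation Tu kH_neq0 dlu dlcu dl0u logqM dlogq_equiv.
(* By the tail representation the exponential in the formula is [q ^ (beta - 1) / M ^ (beta - 1)] at
   [Num.max s u]. The integrand is thus [G], which is [y'] beyond [u] and continuous on the whole
   ray. *)
pose G s := q (Num.max s u) `^ (beta - 1) * r s `^ (1 - beta).
pose gM s := M `^ (beta - 1) * r s `^ (1 - beta) *
  expR (- \int[lebesgue_measure]_(xi in `[s, +oo[) ((1 + eps xi) * k * H xi)).
have gE s : T <= s -> gM s = G s.
  move=> Ts; have mu_ge : u <= Num.max s u by rewrite le_max lexx orbT.
  have [_ qm _ _ _] := Hu _ mu_ge.
  rewrite /gM epsE// opprB expRB expR_logq//.
  have -> : expR ((beta - 1) * ln M) = M `^ (beta - 1) by rewrite /powR gt_eqF.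
  by rewrite /G; field; rewrite gt_eqF// powR_gt0.
have cG t : {within `[T, t], continuous G}.
  have cq : continuous (fun s => q (Num.max s u) `^ (beta - 1)).
    move=> s; have mu_ge : u <= Num.max s u by rewrite le_max lexx orbT.
    have [_ qm cqm _ _] := Hu _ mu_ge.
    have cqs := continuous_for_comp (f := q) (@continuous_max_cst R u s) cqm.
    exact: (@continuous_for_powR R (fun x => q (Num.max x u)) _ _ cqs qm).
  have cr : {within `[T, t], continuous (fun s => r s `^ (1 - beta))}.
    apply: within_continuous_powR.
      by apply: continuous_subspaceW r_cont_ray; exact: subset_itvl.
    by move=> x /=; rewrite in_itv/= => /andP[Tx _]; exact: r_gt0_ray.
  exact: within_continuousM (continuous_subspaceT cq) cr.
have iG t : lebesgue_measure.-integrable `[T, t] (EFin \o G).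
  exact: within_continuous_integrable.
(* [A] replaces the integral of [G] over [[T, u]], where [G] need not be [y'], by the true value
   [y u]. *)
exists (y u - \int[lebesgue_measure]_(s in `[T, u]) G s), eps; split => //.
  move=> t Tt; apply: eq_integrable (iG t) => //.
  by move=> s; rewrite inE/= in_itv/= => /andP[Ts _]; rewrite /= -gE.
near=> t.
have ut : u <= t by [].
have -> : \int[lebesgue_measure]_(s in `[T, t]) gM s =
    \int[lebesgue_measure]_(s in `[T, t]) G s.
  by apply: eq_Rintegral => s; rewrite inE/= in_itv/= => /andP[Ts _]; exact: gE.
have iGu : lebesgue_measure.-integrable `[u, t] (EFin \o G).
  by apply: integrableS (iG t) => //; apply: subset_itvr; rewrite bnd_simp.
have split_int : \int[lebesgue_measure]_(s in `[T, t]) G s -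
    \int[lebesgue_measure]_(s in `[T, u]) G s =
    \int[lebesgue_measure]_(s in `[u, t]) G s.
  rewrite (Rintegral_itvB (iG t)) ?bnd_simp//.
  rewrite Rintegral_itv_obnd_cbnd//.
  by apply: integrableS iGu => //; exact: subset_itv_oc_cc.
have GE : \int[lebesgue_measure]_(s in `[u, t]) G s =
    \int[lebesgue_measure]_(s in `[u, t]) dy s.
  apply: eq_Rintegral => s; rewrite inE/= in_itv/= => /andP[us _].
  by have [_ _ _ -> _] := Hu _ us; rewrite /G max_l.
have := fundamental_theorem ut (fun x ux => let: And5 _ _ _ _ (And5 _ _ _ d _) :=
  Hu x ux in d) (fun x ux => let: And5 _ _ _ _ (And5 _ _ _ _ c) := Hu x ux in c).
by rewrite -GE -split_int => E; lra.
Unshelve. all: end_near. Qed.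

End integrals.

Lemma quasi_limit_remainder (M : R) : 0 < M -> q t @[t --> +oo] --> M ->
  SV (fun t => M - quasi alpha r y t) /\
  t `^ (delta + alpha) * tau' t `^ (alpha - 1) * Lpart delta p t /
    (tau t `^ (delta + alpha) * Lpart (delta + alpha) r t *
      (M - quasi alpha r y t)) @[t --> +oo] --> 0.
Proof.
move=> M0 qM; have [Mq lim] := quasi_remainder M0 qM; split.
  have MqE : \forall t \near +oo, M - q t = M - quasi alpha r y t.
    by apply: filterS quasiE => t ->.
  have Mquasi := regularly_varying_eq MqE Mq; have [Mpos _] := Mquasi.
  have cquasi := quasi_cont.
  have [X HX] : exists X : R, forall t : R, X <= t ->
      {for t, continuous (quasi alpha r y)} /\ 0 < M - quasi alpha r y t.
    by apply: eventually_exists; near=> t; split; near: t.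
  apply: (@regularly_varying_RV _ _ X) Mquasi => t /HX[]// ct _.
  by apply: continuousB => //; exact: cst_continuous.
by apply: cvg_near_eq lim; near=> t; rewrite (near quasiE t).
Unshelve. all: end_near. Qed.

(** Gathers what holds for one increasing solution in terms free of the auxiliary [dy], [q] and
    [z]. *)
Lemma solution_properties :
  [/\ NRV rho y,
      Pi_class (fun t => t * p t * Phi alpha (y (tau t))) (quasi alpha r y),
      y t @[t --> +oo] --> +oo &
      forall T, (forall t, T <= t -> 0 < H t) -> {within `[T, +oo[, continuous H} ->
        (forall t, T <= t -> 0 < r t) -> {within `[T, +oo[, continuous r} ->
        formula_infinite alpha beta rho T r H y /\
        ((\int[lebesgue_measure]_(s in `[T, +oo[) (H s)%:E = +oo)%E ->
          quasi alpha r y t @[t --> +oo] --> +oo) /\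
        ((\int[lebesgue_measure]_(s in `[T, +oo[) (H s)%:E < +oo)%E ->
          exists M : R, [/\ 0 < M, quasi alpha r y t @[t --> +oo] --> M,
            formula_finite alpha beta rho T M r H y,
            SV (fun t => M - quasi alpha r y t) &
            t `^ (delta + alpha) * tau' t `^ (alpha - 1) * Lpart delta p t /
              (tau t `^ (delta + alpha) * Lpart (delta + alpha) r t *
                (M - quasi alpha r y t)) @[t --> +oo] --> 0])].
Proof.
split; [exact: y_NRV|exact: quasi_Pi|exact: y_pinfty|].
move=> T H0 cH r0 cr; split; first exact: y_formula_infinite.
split; first exact: quasi_unbounded.
move=> HI; have [M M0 qM] := quasi_bounded H0 cH HI; exists M.
have [SVM lim] := quasi_limit_remainder M0 qM.
split => //; last exact: y_formula_finite.
by apply: cvg_near_eq qM; apply: filterS quasiE => t ->.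
Qed.

End solution.
End half_linear.

(** * Solutions in the sense of the definitions *)

Section solutions.
Context {R : realType}.
Implicit Types f g y : R -> R.

Lemma has_deriv_on_ray (t0 : R) f f' : has_deriv_on `[t0, +oo[ f f' ->
  forall t, t0 < t -> is_derive t 1 f (f' t).
Proof.
move=> ff' t tt0.
have It : [set` `[t0, +oo[] t by rewrite /= in_itv/= andbT ltW.
have lim : h^-1 *: (f (h *: 1 + t) - f t) @[h --> 0^'] --> f' t.
  apply/cvgrPdist_le => e e0.
  have /cvgrPdist_le /(_ _ e0) := ff' t It.
  rewrite near_withinE near_withinE => /nbhs_ballP[d /= d0 Hd].
  (* The bound [t - t0] keeps [t + h] inside the ray, so the restricted difference quotient becomes
     the two-sided one. *)
  have dt0 : 0 < Num.min d (t - t0) by rewrite lt_min d0 subr_gt0.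
  apply/nbhs_ballP; exists (Num.min d (t - t0)) => //= h.
  rewrite /ball/= sub0r normrN lt_min => /andP[hd ht] h0.
  have bt : ball t d (t + h).
    by rewrite /ball/= opprD addrA subrr sub0r normrN.
  have th : t + h != t by rewrite -subr_eq0 addrC addKr.
  have Ith : t + h \in `[t0, +oo[.
    rewrite in_itv/= andbT.
    by move: ht; rewrite ltr_norml => /andP[]; lra.
  have := Hd _ bt th Ith.
  rewrite (_ : t + h - t = h); last by rewrite addrC addKr.
  by rewrite /GRing.scale/= mulr1 [h + t]addrC [h^-1 * _]mulrC.
apply: DeriveDef; first by apply/cvg_ex; exists (f' t).
exact: cvg_lim lim.
Qed.

(** At the endpoint, [f s] is written as the one-sided difference quotient times [s - a], plus
    [f a]. *)
Lemma has_deriv_on_continuous (a : R) f f' : has_deriv_on `[a, +oo[ f f' ->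
  {within `[a, +oo[, continuous f}.
Proof.
move=> ff'; apply/continuous_within_itvcyP; split.
  move=> x; rewrite in_itv/= andbT => ax.
  exact: is_derive_continuous (has_deriv_on_ray ff' ax).
have Ia : [set` `[a, +oo[] a by rewrite /= in_itv/= lexx.
have quot : (f s - f a) / (s - a) @[s --> a^'+] --> f' a.
  apply/cvgrPdist_le => e e0.
  have /cvgrPdist_le /(_ _ e0) := ff' a Ia.
  rewrite near_withinE near_withinE => /nbhs_ballP[d /= d0 Hd].
  near=> s.
  have as_ : a < s by near: s; exact: nbhs_right_gt.
  have sd : s < a + d by near: s; apply: nbhs_right_lt; rewrite ltrDl.
  apply: Hd; rewrite ?in_itv/= ?andbT ?(ltW as_) ?gt_eqF//.
  by rewrite /ball/= distrC gtr0_norm ?subr_gt0//; lra.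
have sa : s - a @[s --> a^'+] --> 0.
  rewrite -(subrr a); apply: cvgB; last exact: cvg_cst.
  by apply: cvg_at_right_filter; exact: cvg_id.
have lim : (f s - f a) / (s - a) * (s - a) + f a @[s --> a^'+] --> f' a * 0 + f a.
  by apply: cvgD; [exact: cvgM|exact: cvg_cst].
rewrite mulr0 add0r in lim.
apply: cvg_trans lim; apply: near_eq_cvg; near=> s.
have as_ : a < s by near: s; exact: nbhs_right_gt.
by rewrite divfK ?subrK// subr_eq0 gt_eqF.
Unshelve. all: end_near. Qed.

Lemma has_deriv_on_nondecreasing (a : R) f f' : has_deriv_on `[a, +oo[ f f' ->
  (forall t, a <= t -> 0 < f' t) ->
  forall s t, a <= s -> s <= t -> f s <= f t.
Proof.
move=> ff' f0 s t as_ st.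
have [x| |x] := @MVT_segment _ f f' s t st.
- rewrite in_itv/= => /andP[sx _]; apply: has_deriv_on_ray ff' _ _.
  exact: le_lt_trans sx.
- apply: continuous_subspaceW (has_deriv_on_continuous ff').
  move=> x /=; rewrite !in_itv/= andbT => /andP[sx _]; exact: le_trans sx.
rewrite in_itv/= => /andP[sx _] E; rewrite -subr_ge0 E mulr_ge0 ?subr_ge0//.
by rewrite ltW// f0// (le_trans as_).
Qed.

Variables (alpha a : R) (r p tau : R -> R).

Lemma Ssol_eventually y : Ssol alpha a r p tau y ->
  exists dy : R -> R, [/\ \forall t \near +oo, is_derive (t : R) 1 y (dy t),
    \forall t \near +oo, 0 < y t, \forall t \near +oo, {for t, continuous dy},
    \forall t \near +oo, derive1 y t = dy t &
    \forall t \near +oo, is_derive (t : R) 1 (fun t => r t * Phi alpha (dy t))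
      (p t * Phi alpha (y (tau t)))].
Proof.
move=> [t0 [_ [dy [dq [[ydy cdy] [qdq _] eqn]]] y0]].
have yder t : t0 < t -> is_derive t 1 y (dy t) by exact: has_deriv_on_ray.
exists dy; split; near=> t;
  have tt0 : t0 < t by near: t; apply: nbhs_pinfty_gt; rewrite num_real.
- exact: yder.
- by apply: y0; exact: ltW.
- exact: within_continuous_for cdy _ tt0.
- by rewrite derive1E (@derive_val _ _ _ _ _ _ _ (yder t tt0)).
- have := has_deriv_on_ray qdq tt0; rewrite eqn//=.
  by rewrite in_itv/= andbT ltW.
Unshelve. all: end_near. Qed.

Lemma ISsol_eventually y : tau t @[t --> +oo] --> +oo ->
  ISsol alpha a r p tau y ->
  exists dy : R -> R, [/\ \forall t \near +oo, is_derive (t : R) 1 y (dy t),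
    \forall t \near +oo, 0 < y t, \forall t \near +oo, 0 < dy t,
    \forall t \near +oo, {for t, continuous dy} &
    (\forall t \near +oo, is_derive (t : R) 1
      (fun t => r t * dy t `^ (alpha - 1)) (p t * y (tau t) `^ (alpha - 1))) /\
    \forall t \near +oo, quasi alpha r y t = r t * dy t `^ (alpha - 1)].
Proof.
move=> tauy [Sy dy0].
have [dy [yder y0 cdy dyE qder]] := Ssol_eventually Sy.
have dypos : \forall t \near +oo, 0 < dy t.
  by near=> t; have <- : derive1 y t = dy t by [near: t]; near: t.
exists dy; split => //; split.
  have qE : \forall t \near +oo, r t * Phi alpha (dy t) = r t * dy t `^ (alpha - 1).
    by apply: filterS dypos => t dyt; rewrite Phi_gt0E.
  have := near_eq_derive_at qE qder; have y0tau := near_comp tauy y0.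
  move=> D; near=> t; rewrite -(@Phi_gt0E _ alpha (y (tau t))).
    by near: t.
  by near: t.
near=> t; have dyt : 0 < dy t by near: t.
rewrite /quasi; have -> : derive1 y t = dy t by near: t.
by rewrite Phi_gt0E.
Unshelve. all: end_near. Qed.

(** The quasiderivative [Q] is nondecreasing. Once positive it stays so, and then [y' > 0]; if it
    never becomes positive, [y] is eventually nonincreasing, contrary to
    [y (2 * t) / y t -> 2 ^ theta > 1]. *)
Lemma regularly_varying_solution_increasing (theta : R) y : 0 < theta ->
  (\forall t \near +oo, 0 < r t) -> (\forall t \near +oo, 0 < p t) ->
  tau t @[t --> +oo] --> +oo -> Ssol alpha a r p tau y ->
  regularly_varying theta y -> ISsol alpha a r p tau y.
Proof.
move=> theta0 r0 p0 tauy Sy [_ yrv]; split => //.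
have [dy [yder y0 cdy dyE qder]] := Ssol_eventually Sy.
pose Q t := r t * Phi alpha (dy t).
have dQ0 : \forall t \near +oo, 0 < p t * Phi alpha (y (tau t)).
  have y0tau := near_comp tauy y0; near=> t.
  apply: mulr_gt0; first by near: t.
  by rewrite Phi_gt0E ?powR_gt0//; near: t.
have [u Hu] : exists u : R, forall t : R, u <= t -> [/\ 0 < t, 0 < r t,
    is_derive t 1 y (dy t), derive1 y t = dy t &
    is_derive t 1 Q (p t * Phi alpha (y (tau t))) /\
      (0 < p t * Phi alpha (y (tau t)) /\ 0 < y t)].
  apply: eventually_exists; near=> t.
  by split; [| | | |split; [|split]]; near: t => //;
    apply: nbhs_pinfty_gt; rewrite num_real.
have Qincr : forall s t, u <= s -> s <= t -> Q s <= Q t.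
  by apply: (@nneg_derive_nondecreasing _ Q
    (fun t => p t * Phi alpha (y (tau t)))) => x /Hu[_ _ _ _ [dQ [/ltW]]].
have dy_le0 t : u <= t -> Q t <= 0 -> dy t <= 0.
  move=> ut Qt; rewrite leNgt; apply/negP => dyt; move: Qt; apply/negP.
  have [_ rt _ _ _] := Hu t ut.
  by rewrite -ltNge /Q Phi_gt0E// mulr_gt0// powR_gt0.
have [[t ut Qt]|nQ] := pselect (exists2 t, u <= t & 0 < Q t).
  near=> s.
  have ts : t <= s by near: s; apply: nbhs_pinfty_ge; rewrite num_real.
  have us := le_trans ut ts.
  have [_ rs _ -> _] := Hu s us.
  rewrite ltNge; apply/negP => dys.
  have : Q s <= 0 by rewrite /Q mulr_ge0_le0// ?(ltW rs)// Phi_le0.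
  by apply/negP; rewrite -ltNge (lt_le_trans Qt)// Qincr.
have ydecr s t : u <= s -> s <= t -> y t <= y s.
  move=> us st; rewrite -lerN2.
  apply: (@nneg_derive_nondecreasing _ (fun x => - y x) (fun x => - dy x) u) => //.
    by move=> x /Hu[_ _ d _ _]; exact: is_deriveN.
  move=> x ux; rewrite oppr_ge0; apply: dy_le0 => //.
  by rewrite leNgt; apply/negP => Qx; apply: nQ; exists x.
have theta1 : 1 < 2 `^ theta :> R by rewrite powR_gt1// ltr1n.
have y2 := near_cvg_gt (yrv 2 (ltr0Sn R 1)) theta1.
exfalso.
have [v Hv] := eventually_exists y2.
have um : u <= Num.max u v by rewrite le_max lexx.
have [m0 _ _ _ [_ [_ ym]]] := Hu _ um.
have : 1 < y (2 * Num.max u v) / y (Num.max u v).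
  by apply: Hv; rewrite le_max lexx orbT.
rewrite ltr_pdivlMr// mul1r; apply/negP; rewrite -leNgt ydecr//.
by rewrite ler_peMl ?(ltW m0)// ler1n.
Unshelve. all: end_near. Qed.

End solutions.

Lemma limsup_ratio_bounded (R : realType) (tau : R -> R) :
  (limf_esup (fun t : R => (t / tau t)%:E) (+oo)%R < +oo)%E ->
  tau t @[t --> +oo] --> +oo ->
  exists K : R, \forall t \near +oo, t <= K * tau t.
Proof.
move=> lsup tauy; have tau0 : \forall t \near +oo, 0 < tau t.
  by move/cvgryPgt : tauy; exact.
move: lsup; rewrite /limf_esup => /ereal_inf_lt[_ [A FA <-]].
case E : ereal_sup => [K| |] // _.
  exists K; near=> t.
  have taut : 0 < tau t by near: t.
  have At : A t by near: t.
  rewrite -ler_pdivrMr// -lee_fin -E; apply: ereal_sup_ubound.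
  by exists t.
(* A supremum equal to [-oo] would force the set [A] to be empty, but it contains all large [t]. *)
exists 0; near=> t.
have At : A t by near: t.
have : ((t / tau t)%:E <= -oo)%E by rewrite -E; apply: ereal_sup_ubound; exists t.
by [].
Unshelve. all: end_near. Qed.

(* T is the lower limit replacing a in the integrals that involve r (tau s);
   it is any number >= a with tau T >= a. *)
Theorem theorem3p4 (R : realType) (a alpha beta delta : R)
  (r p tau tau' : R -> R)
  (a_gt0 : 0 < a)
  (alpha_gt1 : 1 < alpha)
  (conj_ab : alpha^-1 + beta^-1 = 1)
  (r_cont : {within `[a, +oo[, continuous r})
  (r_gt0 : forall t, a <= t -> 0 < r t)
  (p_cont : {within `[a, +oo[, continuous p})
  (p_gt0 : forall t, a <= t -> 0 < p t)
  (tau_C1 : C1_on `[a, +oo[ tau tau')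
  (tau'_gt0 : forall t, a <= t -> 0 < tau' t)
  (tau_le : forall t, a <= t -> tau t <= t)
  (tau_infty : tau t @[t --> +oo] --> +oo)
  (tau_limsup : (limf_esup (fun t : R => (t / tau t)%:E) (+oo)%R < +oo)%E)
  (delta_lt : delta < -1)
  (p_RV : RV delta p)
  (r_RV : RV (delta + alpha) r)
  (rtau_RV : RV (delta * (1 - beta) - beta)
    (fun t => r (tau t) `^ (1 - beta) * tau' t))
  (L_lim : (Lpart delta p t / Lpart (delta + alpha) r t) `^ (beta - 1) * tau' t
     @[t --> +oo] --> 0) :
  let rho := (- 1 - delta) / (alpha - 1) in
  let IS := ISsol alpha a r p tau in
  let H := Htau alpha r p tau tau' in
  [/\ IS `<=` NRV rho,
      (forall y, IS y ->
        Pi_class (fun t => t * p t * Phi alpha (y (tau t))) (quasi alpha r y)) &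
      forall T, a <= T -> a <= tau T ->
      ((\int[lebesgue_measure]_(s in `[T, +oo[) (H s)%:E = +oo)%E ->
        [/\ (forall y, IS y -> formula_infinite alpha beta rho T r H y),
            S_NRV alpha a r p tau rho = S_RV alpha a r p tau rho,
            S_RV alpha a r p tau rho = IS &
            IS = ISuv alpha a r p tau Infty Infty])
      /\
      ((\int[lebesgue_measure]_(s in `[T, +oo[) (H s)%:E < +oo)%E ->
        [/\ (forall y, IS y ->
              exists M : R,
                [/\ 0 < M,
                    quasi alpha r y t @[t --> +oo] --> M,
                    formula_finite alpha beta rho T M r H y,
                    SV (fun t => M - quasi alpha r y t) &
                    t `^ (delta + alpha) * tau' t `^ (alpha - 1) *
                      Lpart delta p t /
                    (tau t `^ (delta + alpha) * Lpart (delta + alpha) r t *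
                      (M - quasi alpha r y t)) @[t --> +oo] --> 0]),
            S_NRV alpha a r p tau rho = S_RV alpha a r p tau rho,
            S_RV alpha a r p tau rho = IS &
            IS = ISuv alpha a r p tau Infty Bnd])].
Proof.
move=> rho IS H.
have r_rv := RV_regularly_varying r_RV; have [r0 _] := r_rv.
have p_rv := RV_regularly_varying p_RV; have [p0 _] := p_rv.
have g_rv := RV_regularly_varying rtau_RV.
have rc := near_within_continuous r_cont.
have pc := near_within_continuous p_cont.
have [tau_d tau'_c] := tau_C1.
have tau'c := near_within_continuous tau'_c.
have tau_der : \forall t \near +oo, is_derive (t : R) 1 tau (tau' t).
  apply: filterS (nbhs_pinfty_gt (num_real a)); exact: has_deriv_on_ray.
have tau'0 : \forall t \near +oo, 0 < tau' t.
  exact: filterS tau'_gt0 (nbhs_pinfty_ge (num_real a)).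
have taule : \forall t \near +oo, tau t <= t.
  exact: filterS tau_le (nbhs_pinfty_ge (num_real a)).
have [K tauge] := limsup_ratio_bounded tau_limsup tau_infty.
have rho0 : 0 < rho by exact: rho_gt0.
have prop y (ISy : IS y) :=
  let: ex_intro dy (And5 yd y0 dy0 dyc (conj qd qE)) :=
    ISsol_eventually tau_infty ISy in
  solution_properties alpha_gt1 conj_ab delta_lt rc r_rv pc p_rv tau_der tau'c
    tau'0 tau_infty taule tauge g_rv L_lim yd y0 dy0 dyc qd qE.
(* The equalities of classes come from the cycle [IS], [S_NRV], [S_RV], [IS] of inclusions. *)
have IS_NRV : IS `<=` NRV rho by move=> y /prop[].
have RV_IS : S_RV alpha a r p tau rho `<=` IS.
  move=> y [Sy /RV_regularly_varying].
  exact: regularly_varying_solution_increasing.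
have NRV_RV : S_NRV alpha a r p tau rho `<=` S_RV alpha a r p tau rho.
  move=> y [Sy /NRV_regularly_varying yrv]; split => //.
  (* The measurability demanded by [RV] is taken from the continuity of the solution. *)
  have [dy [yd y0 _ _ _]] := Ssol_eventually Sy.
  have [X HX] : exists X : R, forall t : R, X <= t ->
      is_derive t 1 y (dy t) /\ 0 < y t.
    by apply: eventually_exists; near=> t; split; near: t.
  apply: (@regularly_varying_RV _ _ X) yrv => t /HX[]// yt _.
  exact: is_derive_continuous yt.
have IS_S_NRV : IS `<=` S_NRV alpha a r p tau rho.
  by move=> y ISy; split; [case: ISy|exact: IS_NRV].
have NRV_eq : S_NRV alpha a r p tau rho = S_RV alpha a r p tau rho.
  apply/seteqP; split => //; exact: subset_trans IS_S_NRV.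
have RV_eq : S_RV alpha a r p tau rho = IS.
  apply/seteqP; split => //; exact: subset_trans NRV_RV.
split => //; first by move=> y /prop[].
move=> T aT ataT.
(* As [tau] increases, the single condition [a <= tau T] makes [H] positive and continuous on all of
   [[T, +oo[]. *)
have tau_a t : T <= t -> a <= tau t.
  move=> Tt; rewrite (le_trans ataT)//.
  exact: has_deriv_on_nondecreasing tau_d tau'_gt0 _ _ aT Tt.
have a_le t : T <= t -> a <= t by exact: le_trans.
have H0 t : T <= t -> 0 < H t.
  move=> Tt; have at_ := a_le t Tt.
  rewrite /H /Htau mulr_gt0//.
    by rewrite powR_gt0// mulr_gt0// ?tau'_gt0// (lt_le_trans a_gt0).
  by rewrite divr_gt0// ?p_gt0// r_gt0// tau_a.
have ray : [set` `[T, +oo[] `<=` [set` `[a, +oo[].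
  by move=> t /=; rewrite !in_itv/= !andbT; exact: a_le.
have Hc : {within `[T, +oo[, continuous H}.
  have tauc := has_deriv_on_continuous tau_d.
  apply: within_continuousM.
    apply: within_continuous_powR.
      apply: within_continuousM; last exact: continuous_subspaceW ray tau'_c.
      by apply: continuous_subspaceT => x; exact: cvg_id.
    move=> t /=; rewrite in_itv/= andbT => /a_le at_.
    by rewrite mulr_gt0// ?tau'_gt0// (lt_le_trans a_gt0).
  apply: within_continuousM; first exact: continuous_subspaceW ray p_cont.
  apply: within_continuousV.
    apply: (within_continuous_comp_within (B := [set` `[a, +oo[]) _ r_cont).
      exact: continuous_subspaceW ray tauc.
    by move=> _ [t /= + <-]; rewrite !in_itv/= !andbT; exact: tau_a.
  move=> t /=; rewrite in_itv/= andbT => Tt.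
  by rewrite gt_eqF// r_gt0// tau_a.
have r0T t : T <= t -> 0 < r t by move=> /a_le; exact: r_gt0.
have rcT : {within `[T, +oo[, continuous r} by exact: continuous_subspaceW ray r_cont.
split=> HI; split => //.
- by move=> y /prop[_ _ _ /(_ T H0 Hc r0T rcT)[]].
- apply/seteqP; split=> [y ISy|y []//].
  have [_ _ yy /(_ T H0 Hc r0T rcT)[_ [/(_ HI) qy _]]] := prop y ISy.
  by split.
- by move=> y /prop[_ _ _ /(_ T H0 Hc r0T rcT)[_ [_ /(_ HI)]]].
- apply/seteqP; split=> [y ISy|y []//].
  have [_ _ yy /(_ T H0 Hc r0T rcT)[_ [_ /(_ HI)]]] := prop y ISy.
  move=> [M [M0 qM _ _ _]]; split => //; exists M; split => //.
  by rewrite gt_eqF.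
Unshelve. all: end_near. Qed.
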